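(* Let $N\ge 1$ be an integer and let $p,r,\theta,q,q^{\ast}$ be real numbers with $$p,r>1,\qquad 0\le\theta\le1,\qquad \frac{1}{q^{\ast}}=\theta\Big(\frac1p-\frac1N\Big)+\frac{1-\theta}{r},\qquad q>q^{\ast}>1.$$ Then there is a positive Schwarz symmetric ground state solution $u$ of the equation $$\lambda_1\Delta_p u-\lambda_2u^{r-1}+u^{q-1}=0\quad\text{on }\mathbb{Z}^N,\qquad u\in D_0^{1,p}(\mathbb{Z}^N)\cap\ell^r(\mathbb{Z}^N),$$ where $\lambda_1,\lambda_2>0$ are constants determined by the parameters $N,p,q,r,\theta$ and $u$. In particular, if $\theta=0$ then the term $\lambda_1\Delta_pu$ is omitted, and if $\theta=1$ then the term $\lambda_2u^{r-1}$ is omitted.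
   Context: $\mathbb{Z}^N$ denotes the integer lattice graph: the vertices are the points of $\mathbb{Z}^N$, and $x\sim y$ (neighbors) iff $\sum_{i=1}^N|x_i-y_i|=1$. The discrete $p$-Laplacian is $\Delta_p u(x)=\sum_{y\sim x}|u(y)-u(x)|^{p-2}(u(y)-u(x))$. For a function $u$ on $\mathbb{Z}^N$, $\|u\|_{\ell^s}=\big(\sum_{x}|u(x)|^s\big)^{1/s}\in[0,\infty]$, $\ell^s(\mathbb{Z}^N)$ is the space of $u$ with $\|u\|_{\ell^s}<\infty$, and $\|u\|_{D^{1,p}}=\big(\sum_{x}\sum_{y\sim x}|u(y)-u(x)|^p\big)^{1/p}$; $D_0^{1,p}(\mathbb{Z}^N)$ is the completion of the finitely supported functions in the norm $\|\cdot\|_{D^{1,p}}$. Ground state solution: a solution that is a minimizer of $K=\inf\{\|u\|_{D^{1,p}}^{\theta}\|u\|_{\ell^r}^{1-\theta}: u\in D_0^{1,p}(\mathbb{Z}^N),\ \|u\|_{\ell^q}=1\}$ (a factor with exponent $0$ being omitted). Discrete Schwarz rearrangement. Let $C_0^+(\mathbb{Z}^N)$ be the set of non-negative functions $u$ on $\mathbb{Z}^N$ with $|\{x:u(x)>t\}|<\infty$ for all $t>0$ (similarly $C_0^+(\mathbb{Z})$, $C_0^+(\mathbb{Z}+\frac12)$). (1) For $f\in C_0^+(\mathbb{Z})$ or $C_0^+(\mathbb{Z}+\frac12)$ with values listed in decreasing order with multiplicity $f_1\ge f_2\ge\cdots$, let $f^\star(x)=f_{1-2x}$ for $x\le 0$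 and $f^\star(x)=f_{2x}$ for $x>0$. (2) Let $e_i$ be the standard unit vectors and $\vec E=\{e_i,\frac{e_i-e_j}{2},\frac{e_i+e_j}{2}:1\le i<j\le N\}$. For $e\in\vec E$, partition $\mathbb{Z}^N$ into classes $V_e^\alpha$, where $x,y$ are in the same class iff $x-y$ is parallel to $e$. On each class the map $x\mapsto\langle e,x\rangle$ is a bijection onto $\mathbb{Z}$ or $\mathbb{Z}+\frac12$; via this identification define $R_eu$ by $(R_eu)|_{V_e^\alpha}=(u|_{V_e^\alpha})^\star$ for each $\alpha$. (3) Let $R^k$ be the composition of the first $k$ terms in the periodic sequence of one-step rearrangements $R_{e_1},R_{e_2},\dots,R_{\frac{e_1-e_2}{2}},\dots,R_{\frac{e_1+e_2}{2}},\dots,R_{e_1},\dots$ (cycling through all $e\in\vec E$ in a fixed order, first applied first). For $u\in C_0^+(\mathbb{Z}^N)$, $u^\star(x)=\lim_{k\to\infty}R^ku(x)$; this limit exists. A function $u\in C_0^+(\mathbb{Z}^N)$ is called Schwarz symmetric if $u=u^\star$.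
   Formalization: For θ=0 ''positive'' is read as nonnegative and nonzero (an everywhere positive solution would be constant, not in ℓ^r); for θ=1, where r is otherwise absent, u∈ℓ^r is not asserted (it fails e.g. for N=3, p=2, q=7, r=2). *)

(* Defs.v *)
From HB Require Import structures.
From mathcomp Require Import all_boot all_order all_algebra.
From mathcomp Require Import all_classical all_reals all_analysis.
Import Order.TTheory GRing.Theory Num.Theory.
Import numFieldNormedType.Exports.

Set Implicit Arguments.
Unset Strict Implicit.
Unset Printing Implicit Defensive.

Local Open Scope classical_set_scope.
Local Open Scope ring_scope.

Notation lattice N := 'rV[int]_N.

Definition neighbors N (x : lattice N) : set (lattice N) :=
  [set y : lattice N | \sum_(i < N) `|x ord0 i - y ord0 i| = 1].

Section Norms.
Context {R : realType} {N : nat}.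
Implicit Types (u : lattice N -> R) (p s : R).

(* The sum ranges over the 2N neighbors of x, a finite set. *)
Definition plaplacian p u (x : lattice N) : R :=
  \sum_(y \in neighbors x) `|u y - u x| `^ (p - 2) * (u y - u x).

Definition lnorm s u : \bar R :=
  ((\esum_(x in [set: lattice N]) (`|u x| `^ s)%:E) `^ s^-1)%E.

Definition ell s : set (lattice N -> R) := [set u | (lnorm s u < +oo)%E].

Definition dnorm p u : \bar R :=
  ((\esum_(x in [set: lattice N])
      \esum_(y in neighbors x) (`|u y - u x| `^ p)%:E) `^ p^-1)%E.

Definition finitely_supported u := finite_set [set x | u x != 0].

(* The completion of the finitely supported functions for dnorm, realized as a
   set of functions: u represents the class of a Cauchy sequence (v n) when
   v n tends to u both pointwise and in dnorm.  For p < N every class has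
   exactly one representative.  For p >= N the constants have zero distance to
   the finitely supported functions, so that a class consists of functions
   differing by constants, of which at most one has a finite l^q norm. *)
Definition D0 p : set (lattice N -> R) :=
  [set u | exists v : nat -> lattice N -> R,
     [/\ forall n, finitely_supported (v n),
         forall x, v n x @[n --> \oo] --> u x
       & dnorm p (fun x => v n x - u x) @[n --> \oo] --> 0%E]].

(* Since a `^ 0 = 1 for every a in \bar R, including +oo, a factor with
   exponent 0 is omitted. *)
Definition gn_functional p r theta u : \bar R :=
  (dnorm p u `^ theta * lnorm r u `^ (1 - theta)%R)%E.

Definition gn_admissible p q : set (lattice N -> R) :=
  [set u | D0 p u /\ lnorm q u = 1%E].

Definition gn_inf p q r theta : \bar R :=
  ereal_inf [set gn_functional p r theta u | u in gn_admissible p q].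

Definition gn_minimizer p q r theta u : Prop :=
  gn_admissible p q u /\ gn_functional p r theta u = gn_inf p q r theta.

End Norms.

Section Schwarz.
Context {R : realType}.

Definition C0plus {T : Type} : set (T -> R) :=
  [set u | (forall x, 0 <= u x) /\
           forall t : R, 0 < t -> finite_set [set x | t < u x]].

(* f 0 >= f 1 >= ... lists with multiplicity the values of u on V.  If u has
   infinitely many positive values, all of them are listed and zeros are not,
   hence the last condition. *)
Definition decreasing_listing {T : Type} (V : set T) (u : T -> R)
    (f : nat -> R) : Prop :=
  exists sigma : nat -> T,
    [/\ injective sigma /\ (forall k, V (sigma k)),
        forall k, f k = u (sigma k),
        {homo f : m n / (m <= n)%N >-> n <= m}
      & forall x, V x -> 0 < u x -> exists k, sigma k = x].

Definition decreasing_values {T : Type} (V : set T) (u : T -> R) : nat -> R :=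
  get [set f | decreasing_listing V u f].

(* Position, counted from 1, in the decreasing listing of the value put at s,
   where 2 * s is an integer. *)
Definition star_index (s : rat) : nat :=
  if s <= 0 then Num.truncn (1 - 2 * s) else Num.truncn (2 * s).

Context {N : nat}.

Definition unit_vec (i : 'I_N) : 'rV[rat]_N := delta_mx ord0 i.

Definition index_pairs : seq ('I_N * 'I_N) :=
  [seq ij : 'I_N * 'I_N <- enum {: 'I_N * 'I_N} | (ij.1 < ij.2)%N].

Definition directions : seq 'rV[rat]_N :=
  [seq unit_vec i | i <- enum 'I_N] ++
  [seq 2^-1 *: (unit_vec ij.1 - unit_vec ij.2) | ij <- index_pairs] ++
  [seq 2^-1 *: (unit_vec ij.1 + unit_vec ij.2) | ij <- index_pairs].

Definition dir_class (e : 'rV[rat]_N) (x : lattice N) : set (lattice N) :=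
  [set y : lattice N | exists t : rat, map_mx intr (x - y) = t *: e].

Definition dir_coord (e : 'rV[rat]_N) (x : lattice N) : rat :=
  \sum_(i < N) e ord0 i * (x ord0 i)%:~R.

(* Each class is identified with Z or Z + 1/2 by dir_coord e. *)
Definition one_step (e : 'rV[rat]_N) (u : lattice N -> R) : lattice N -> R :=
  fun x => decreasing_values (dir_class e x) u (star_index (dir_coord e x)).-1.

Fixpoint iter_steps (k : nat) (u : lattice N -> R) : lattice N -> R :=
  if k is k'.+1 then
    one_step (nth 0 directions (k' %% size directions)) (iter_steps k' u)
  else u.

Definition schwarz (u : lattice N -> R) : lattice N -> R :=
  fun x => lim (iter_steps k u x @[k --> \oo]).

Definition schwarz_symmetric (u : lattice N -> R) : Prop :=
  C0plus u /\ u = schwarz u.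

End Schwarz.

(* Main.v *)
Require Import Defs.
From HB Require Import structures.
From mathcomp Require Import all_boot all_order all_algebra.
From mathcomp Require Import finmap.
From mathcomp Require Import all_classical all_reals all_analysis.
From mathcomp Require Import ring lra zify.
Import Order.TTheory GRing.Theory Num.Theory.
Import numFieldNormedType.Exports.
Set Implicit Arguments.
Unset Strict Implicit.
Local Open Scope classical_set_scope.
Local Open Scope ring_scope.

(** For a function u on the lattice write A(u) for the sum of |u(y) - u(x)|^p
over ordered edges and B(u), Q(u) for the sums of |u|^r and |u|^q, so that the
functional to be minimized on Q = 1 is G(u) = A(u)^(theta/p) B(u)^((1-theta)/r).
If theta = 0, the indicator of the origin is a minimizer: Q(v) = 1 forces
|v| <= 1, hence B(v) >= Q(v).  From now on theta > 0.

Symmetrization.  A function is fixed by all one-step rearrangements exactly when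
it decreases away from the center along every line in the given directions, and
this is a statement about pairs of points exchanged by a reflection of the
lattice.  So the rearrangements are replaced by polarizations (two-point
rearrangements) with respect to these reflections.  They are automorphisms of the
lattice graph, and an edge that crosses the mirror joins a point to its own
reflection; therefore a polarization decreases A by a four-point convexity
inequality ([powR_two_point], [energy_pol]) and keeps all l^s norms.  For a
finitely supported u, each polarization that changes something lowers the sum of
u(x) h(x), with h the squared distance to a generic point near the origin, by a
fixed amount, so that finitely many of them produce a symmetric function
([symmetrize]).  Since (|v| - e)^+ is finitely supported and does not increase A
or B, there is a minimizing sequence of finitely supported symmetric functions
([near_minimizer]).

Decay.  If w is symmetric then its value at x is at most its value at any point
much closer to the origin ([symm_far]).  Comparing w(x) with the values on a cube
of side m, comparable to |x|, gives w(x) <= C B^(1/r) m^(-N/r); comparing w on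
parallel segments that start in this cube and leave a larger one gives
w(x) - w(z) <= C A^(1/p) m^(1-N/p) for z farther out than x by a fixed factor.
The geometric mean of the two bounds with weights 1 - theta and theta is
C G(w) m^(-N/qstar), and since N/qstar > 0 these increments can be summed along
a geometric sequence of radii ([ray_decay]).  This gives
w(x) <= C G(w) |x|^(-N/qstar) for all p and N at once, and as q > qstar the
tails of Q(w) are small uniformly on the minimizing sequence ([uniform_tail]).

Limit.  Let u be the pointwise limit of the sequence along an ultrafilter.  It is
symmetric, Q(u) = 1 by the uniform tails, and G(u) is at most the infimum because
every finite partial sum passes to the limit ([exists_symmetric_limit],
[functional_from_finite]).  Truncating u at small heights shows that it lies in
the completion ([D0_of_levels]).  So u is a minimizer, and being symmetric it is
fixed by every one-step rearrangement, hence equal to its Schwarz rearrangement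
([symm_schwarz]).

Equation.  Along u + t delta_x the three sums A, B, Q are explicit differentiable
functions of t, and t = 0 minimizes
(theta/p) log A + ((1-theta)/r) log B - (1/q) log Q.  The vanishing derivative is
the equation, with lambda1 = 2 theta / A and lambda2 = (1 - theta) / B
([euler_lagrange]).  At a zero of u the equation says that the sum of u(y)^(p-1)
over the neighbors y vanishes, so the zero set contains the neighbors of its
points; as the lattice is connected and u is not zero, u is positive. *)

(** * Sums of nonnegative families *)

Section EsumTools.
Context {R : realType} {T : choiceType}.
Implicit Types (D : set T) (f g : T -> R).

Lemma sum_fset_esum D f (F : {fset T}) : [set` F] `<=` D ->
  ((\sum_(x <- F) f x)%:E <= \esum_(x in D) (f x)%:E)%E.
Proof.
move=> FD; apply: esum_ge; exists [set` F]; first by split.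
by rewrite fsbig_finite//= set_fsetK sumEFin.
Qed.

Lemma esum_le_fset D f (c : \bar R) :
  (forall F : {fset T}, [set` F] `<=` D -> ((\sum_(x <- F) f x)%:E <= c)%E) ->
  (\esum_(x in D) (f x)%:E <= c)%E.
Proof.
move=> H; apply: ge_ereal_sup => _ [X [finX XD] <-].
rewrite fsbig_finite//= sumEFin; apply: H.
by move=> x /=; rewrite in_fset_set// inE; exact: XD.
Qed.

Lemma esum_gt_fset D f (c : \bar R) : (c < \esum_(x in D) (f x)%:E)%E ->
  exists2 F : {fset T}, [set` F] `<=` D & (c < (\sum_(x <- F) f x)%:E)%E.
Proof.
move=> H; apply: contrapT => nF.
suff : (\esum_(x in D) (f x)%:E <= c)%E by rewrite leNgt H.
apply: esum_le_fset => F FD.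
by rewrite leNgt; apply/negP => cF; apply: nF; exists F.
Qed.

Lemma esum_tail D f (e : R) : (forall x, D x -> 0 <= f x) ->
  (\esum_(x in D) (f x)%:E < +oo)%E -> 0 < e ->
  exists2 F : {fset T}, [set` F] `<=` D &
    (\esum_(x in D `&` ~` [set` F]) (f x)%:E <= e%:E)%E.
Proof.
move=> f0 fin e0.
have ge0 : (0 <= \esum_(x in D) (f x)%:E)%E.
  by apply: esum_ge0 => x Dx; rewrite lee_fin f0.
have fn : (\esum_(x in D) (f x)%:E)%E \is a fin_num by rewrite ge0_fin_numE.
have : (\esum_(x in D) (f x)%:E - e%:E < \esum_(x in D) (f x)%:E)%E.
  by rewrite lteBlDr// lteDl// lte_fin.
move=> /esum_gt_fset[F FD HF]; exists F => //.
have HD := @esumID R T [set` F] D (fun x => (f x)%:E).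
rewrite {}HD in HF fn; last by move=> x Dx; rewrite lee_fin f0.
move: HF; rewrite (_ : D `&` [set` F] = [set` F]); last first.
  by apply/seteqP; split => [x []//|x Fx]; split => //; exact: FD.
rewrite esum_fset//; last by move=> x /[!inE] /FD Dx; rewrite lee_fin f0.
rewrite fsbig_finite//= set_fsetK sumEFin.
move: fn; rewrite (_ : D `&` [set` F] = [set` F]); last first.
  by apply/seteqP; split => [x []//|x Fx]; split => //; exact: FD.
rewrite esum_fset//; last by move=> x /[!inE] /FD Dx; rewrite lee_fin f0.
rewrite fsbig_finite//= set_fsetK sumEFin.
case: (esum _ _) => [r| |]//= _.
by rewrite -!EFinD lte_fin lee_fin; lra.
Qed.

Lemma sum_fsetUI f (A B : {fset T}) : (A `<=` B)%fset ->
  \sum_(x <- B) f x = \sum_(x <- A) f x + \sum_(x <- (B `\` A)%fset) f x.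
Proof.
move=> AB; rewrite (big_fsetID _ (fun x => x \in A))/=; congr (_ + _).
  congr (\sum_(x <- enum_fset _) _); apply/fsetP => x; rewrite !inE andbC.
  by case: (boolP (x \in A)) => //= /(fsubsetP AB).
by congr (\sum_(x <- enum_fset _) _); apply/fsetP => x; rewrite !inE andbC.
Qed.

Lemma ler_sum_fsubset f (A B : {fset T}) : (forall x, 0 <= f x) ->
  (A `<=` B)%fset -> \sum_(x <- A) f x <= \sum_(x <- B) f x.
Proof.
by move=> f0 AB; rewrite (sum_fsetUI _ AB) lerDl sumr_ge0.
Qed.

Lemma esumT_fset f (F : {fset T}) : (forall x, x \notin F -> f x = 0) ->
  (forall x, 0 <= f x) ->
  (\esum_(x in [set: T]) (f x)%:E = (\sum_(x <- F) f x)%:E)%E.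
Proof.
move=> fF f0; apply/eqP; rewrite eq_le sum_fset_esum// andbT.
apply: esum_le_fset => G _; rewrite lee_fin.
apply: (le_trans (ler_sum_fsubset f0 (fsubsetUr F G))).
rewrite (sum_fsetUI _ (fsubsetUl F G)) [X in _ + X]big1_seq ?addr0// => x /=.
by rewrite !inE => /andP[/fF].
Qed.

End EsumTools.

Section Pairing.
Context {R : realType} {T : choiceType}.
Variables (D : set T) (s : T -> T).
Hypotheses (sD : forall x, D x -> D (s x)) (sK : forall x, s (s x) = x).

(** An involution s of D allows two sums over D to be compared after grouping x
    with s x: each sum counts every pair twice. All rearrangement inequalities
    below are obtained in this way. *)
Lemma esum_pairing_le (f g : T -> R) :
  (forall x, 0 <= f x) -> (forall x, 0 <= g x) ->
  (forall x, D x -> f x + f (s x) <= g x + g (s x)) ->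
  (\esum_(x in D) (f x)%:E <= \esum_(x in D) (g x)%:E)%E.
Proof.
move=> f0 g0 fg.
have bij : set_bij D D s.
  split; first by move=> x Dx; exact: sD.
    by move=> x y _ _ H; rewrite -(sK x) H sK.
  by move=> x Dx; exists (s x); [exact: sD|rewrite sK].
have H : (\esum_(x in D) (f x)%:E + \esum_(x in D) (f x)%:E <=
          \esum_(x in D) (g x)%:E + \esum_(x in D) (g x)%:E)%E.
  rewrite [X in (_ + X <= _)%E](reindex_esum _ _ _ (fun x => (f x)%:E) bij).
  rewrite [X in (_ <= _ + X)%E](reindex_esum _ _ _ (fun x => (g x)%:E) bij).
  rewrite -!esumD; try by move=> x _; rewrite lee_fin.
  by apply: le_esum => x Dx; rewrite -!EFinD lee_fin fg.
have := esum_ge0 (S := D) (a := fun x => (f x)%:E) (fun x _ => f0 x).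
have := esum_ge0 (S := D) (a := fun x => (g x)%:E) (fun x _ => g0 x).
move: H; case: (esum D _) => [a| |]//; case: (esum D _) => [b| |]//.
by rewrite -!EFinD !lee_fin => *; lra.
by move=> _ _ _; rewrite leey.
Qed.

Lemma esum_pairing_eq (f g : T -> R) :
  (forall x, 0 <= f x) -> (forall x, 0 <= g x) ->
  (forall x, D x -> f x + f (s x) = g x + g (s x)) ->
  (\esum_(x in D) (f x)%:E = \esum_(x in D) (g x)%:E)%E.
Proof.
by move=> f0 g0 fg; apply/eqP; rewrite eq_le !esum_pairing_le// => x /fg ->.
Qed.

End Pairing.

(** * Powers of absolute values *)

Section Powers.
Context {R : realType}.
Implicit Types (a b x y z p s t : R).

Lemma convex_norm_powR p a b t : 1 <= p -> 0 <= t <= 1 ->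
  `|t * a + (1 - t) * b| `^ p <= t * `|a| `^ p + (1 - t) * `|b| `^ p.
Proof.
move=> p1 /andP[t0 t1].
have t01 : 0 <= 1 - t by lra.
apply: (@le_trans _ _ ((t * `|a| + (1 - t) * `|b|) `^ p)).
  apply: ge0_ler_powR; rewrite ?nnegrE//; first lra.
    by rewrite addr_ge0// mulr_ge0.
  by rewrite (le_trans (ler_normD _ _))// !normrM (ger0_norm t0) (ger0_norm t01).
have ti : (0 <= t <= 1)%R by apply/andP.
have := @convex_powR R p p1 (Itv01 t0 t1) `|a| `|b|.
rewrite !inE/= !in_itv/= !normr_ge0 => /(_ isT isT).
by rewrite !convRE /=.
Qed.

(** The pair (y1, y2) has the same sum as (x, z) and lies between them, so that
    y1 and y2 are complementary convex combinations of x and z. *)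
Lemma powR_majorization p x z y1 y2 : 1 <= p -> x <= y1 <= z ->
  y1 + y2 = x + z ->
  `|y1| `^ p + `|y2| `^ p <= `|x| `^ p + `|z| `^ p.
Proof.
move=> p1 /andP[xy yz] E.
have [xz|zx] := ltP x z; last first.
  have -> : y1 = x by lra.
  by have -> : y2 = z by lra.
pose t := (z - y1) / (z - x).
have zx0 : z - x != 0 by lra.
have zxp : 0 < z - x by lra.
have t01 : 0 <= t <= 1.
  by rewrite divr_ge0 ?ler_pdivrMr//=; lra.
have t01' : 0 <= 1 - t <= 1 by lra.
have -> : y1 = t * x + (1 - t) * z by rewrite /t; field.
have -> : y2 = (1 - t) * x + (1 - (1 - t)) * z.
  have -> : y2 = x + z - y1 by lra.
  by rewrite /t; field.
have := convex_norm_powR x z p1 t01.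
have := convex_norm_powR x z p1 t01'.
lra.
Qed.

(** Only the case in which (a, a') and (b, b') are ordered in opposite ways
    needs an argument. The differences b' - a and b - a' produced by sorting
    then lie between b - a and b' - a' and have the same sum. *)
Lemma powR_two_point p a a' b b' : 1 <= p ->
  `|Num.max b b' - Num.max a a'| `^ p + `|Num.min b b' - Num.min a a'| `^ p
  <= `|b - a| `^ p + `|b' - a'| `^ p.
Proof.
move=> p1.
have [bb|bb] := leP b b'; have [aa|aa] := leP a a' => //.
- by rewrite addrC.
- rewrite addrC; apply: powR_majorization => //; [apply/andP; split; lra|lra].
- rewrite [leRHS]addrC; apply: powR_majorization => //; [apply/andP; split; lra|lra].
Qed.

Lemma near_powR_pos s : 0 < s -> forall e : R, 0 < e ->
  exists2 d, 0 < d & forall y, `|y| < d -> `|y| `^ s < e.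
Proof.
move=> s0 e e0; exists (e `^ s^-1); first exact: powR_gt0.
move=> y yd; rewrite -[ltRHS](_ : (e `^ s^-1) `^ s = e).
  by apply: gt0_ltr_powR => //; rewrite nnegrE// powR_ge0.
by rewrite -powRrM mulVf ?gt_eqF// powRr1// ltW.
Qed.

Lemma continuous_norm_powR s : 0 < s -> continuous (fun x => `|x| `^ s).
Proof.
move=> s0 x.
have [->|x0] := eqVneq x 0.
  rewrite /continuous_at normr0 powR0 ?gt_eqF//.
  apply/cvgrPdist_lt => e e0.
  have [d d0 H] := near_powR_pos s0 e0.
  near=> y; rewrite sub0r normrN ger0_norm ?powR_ge0//; apply: H.
  near: y; apply/nbhs_ballP; exists d => //= y.
  by rewrite /ball/= sub0r normrN.
apply: (@continuous_comp _ _ _ (fun x => `|x|) (fun y => y `^ s)).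
  exact: norm_continuous.
have xp : 0 < `|x| by rewrite normr_gt0.
apply/differentiable_continuous/derivable1_diffP.
by have [] := is_derive1_powR s xp.
Unshelve. all: by end_near. Qed.

(** At 0 the difference quotient is |h|^(p-1) up to sign, which tends to 0 as p
    > 1. *)
Lemma is_derive_norm_powR p x : 1 < p ->
  is_derive x 1 (fun t => `|t| `^ p) (p * (`|x| `^ (p - 2) * x)).
Proof.
move=> p1.
have [x0|x0|<-] := ltgtP 0 x.
- have -> : p * (`|x| `^ (p - 2) * x) = p * x `^ (p - 1).
    rewrite gtr0_norm//; congr (_ * _).
    rewrite -[X in _ * X](powRr1 (ltW x0)) -powRD; last by rewrite (gt_eqF x0) implybT.
    by congr powR; lra.
  have H := is_derive1_powR p x0.
  apply: (@near_eq_is_derive _ _ _ (fun t => t `^ p)) => //.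
  near=> t; rewrite gtr0_norm//; near: t; exact: lt_nbhsr.
- have nx0 : 0 < - x by lra.
  have -> : p * (`|x| `^ (p - 2) * x) = p * (- x) `^ (p - 1) * (-1).
    rewrite ltr0_norm// -mulrA; congr (_ * _).
    rewrite mulrN1 -[in LHS](opprK x) mulrN; congr (- _).
    rewrite !opprK.
    rewrite -[X in _ * X](powRr1 (ltW nx0)) -powRD; last by rewrite (gt_eqF nx0) implybT.
    by congr powR; lra.
  have H := is_derive1_powR p nx0.
  have H2 : is_derive x 1 (fun t : R => - t) (-1) by apply: is_deriveN.
  have H3 := @is_derive1_comp R (fun t => powR t p) (fun t => - t) x _ _ H H2.
  apply: (@near_eq_is_derive _ _ _ ((fun t => powR t p) \o (fun t => - t))) => //.
  near=> t; rewrite /= ltr0_norm//; near: t; by apply: lt_nbhsl.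
- rewrite mulr0 mulr0.
  have H : h^-1 *: (`|h *: (1 : R) + 0| `^ p - `|0 : R| `^ p) @[h --> 0^'] --> (0 : R).
    rewrite normr0 powR0; last by lra.
    apply/cvgrPdist_lt => e e0.
    have p10 : 0 < p - 1 by lra.
    have [d d0 Hd] := near_powR_pos p10 e0.
    near=> h.
    have h0 : h != 0 by near: h; exact: nbhs_dnbhs_neq.
    rewrite sub0r normrN subr0 addr0 /GRing.scale/= mulr1 normrM normfV.
    rewrite (ger0_norm (powR_ge0 _ _)) -(mulr_powRB1 (normr_ge0 h)); last lra.
    rewrite mulKf ?normr_eq0//; apply: Hd.
    near: h; apply/nbhs_ballP; exists d => //= y.
    by rewrite /ball/= sub0r normrN.
  apply: DeriveDef.
    by apply/cvg_ex; exists 0.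
  by apply/cvg_lim.
Unshelve. all: by end_near. Qed.
End Powers.

(** * Reflections of the lattice *)

Section Geometry.
Context {N : nat}.
Implicit Types (x y z : lattice N) (c t : int).

(** Code of a direction of rearrangement: [inl i] for e_i, [inr (i, j, b)] for
    (e_i + e_j)/2 or, if b holds, (e_i - e_j)/2. *)
Definition axis := ('I_N + 'I_N * 'I_N * bool)%type.
Implicit Type d : axis.

Definition valid_axis d : bool :=
  if d is inr ((i, j), _) then (i < j)%N else true.

(** The primitive lattice vector w along the direction e. *)
Definition axis_vec d : lattice N :=
  match d with
  | inl i => delta_mx 0 i
  | inr ((i, j), b) => delta_mx 0 i + (-1) ^+ b *: delta_mx 0 j
  end.

(** The form x |-> 2 <e, x>; doubling makes it integral. It grows by 2 along
    [axis_vec], so that the reflections of a line are S |-> 2c - S for integers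
    c. *)
Definition axis_form d x : int :=
  match d with
  | inl i => 2 * x 0 i
  | inr ((i, j), b) => x 0 i + (-1) ^+ b * x 0 j
  end.

Lemma axis_formD d x y : axis_form d (x + y) = axis_form d x + axis_form d y.
Proof. by case: d => [i|[[i j] b]] /=; rewrite !mxE; ring. Qed.

Lemma axis_formZ d t x : axis_form d (t *: x) = t * axis_form d x.
Proof. by case: d => [i|[[i j] b]] /=; rewrite !mxE; ring. Qed.

Lemma axis_form_vec d : valid_axis d -> axis_form d (axis_vec d) = 2.
Proof.
case: d => [i|[[i j] b]] /=; rewrite !mxE !eqxx// => ij.
have ij' : (i == j) = false by apply/negP => /eqP E; rewrite E ltnn in ij.
by rewrite [j == i]eq_sym ij'; case: b.
Qed.

(** Reflection in the hyperplane on which [axis_form d] equals c. *)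
Definition refl d c x : lattice N := x + (c - axis_form d x) *: axis_vec d.

Lemma axis_form_refl d c x : valid_axis d ->
  axis_form d (refl d c x) = 2 * c - axis_form d x.
Proof. by move=> vd; rewrite axis_formD axis_formZ axis_form_vec//; ring. Qed.

Lemma reflK d c x : valid_axis d -> refl d c (refl d c x) = x.
Proof.
move=> vd; rewrite {1}/refl axis_form_refl// /refl -addrA -scalerDl.
rewrite [X in X *: _](_ : _ = 0); last by ring.
by rewrite scale0r addr0.
Qed.

Lemma refl_fix d c x : axis_form d x = c -> refl d c x = x.
Proof. by rewrite /refl => ->; rewrite subrr scale0r addr0. Qed.

Definition unit_step k (s : int) : lattice N := s *: delta_mx 0 k.

Lemma sum_norm_delta (k : 'I_N) (s : int) : \sum_(i < N) `|(unit_step k s) 0 i| = `|s|.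
Proof.
rewrite (bigD1 k)//= big1 ?addr0; first by rewrite !mxE !eqxx mulr1.
by move=> i ik; rewrite !mxE eqxx/= (negbTE ik) mulr0.
Qed.

Lemma neighborsP x y : neighbors x y <->
  exists k s, `|s| = 1 /\ y = x + unit_step k s.
Proof.
split=> [|[k [s [s1 ->]]]]; last first.
  rewrite /neighbors/=.
  under eq_bigr => i _ do rewrite mxE opprD addNKr normrN.
  by rewrite sum_norm_delta.
rewrite /neighbors/= => H.
have [k xk] : exists k, x ord0 k - y ord0 k != 0.
  apply: contrapT => /forallNP nk; move: H; rewrite big1// => i _.
  by have /negP := nk i; rewrite negbK => /eqP ->; rewrite normr0.
exists k, (y ord0 k - x ord0 k).
have kp : 1 <= `|x ord0 k - y ord0 k| by rewrite -gtz0_ge1 normr_gt0.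
move: H; rewrite (bigD1 k)//=.
have S0 : 0 <= \sum_(i < N | i != k) `|x ord0 i - y ord0 i| by apply: sumr_ge0.
move=> H.
have aux (a b : int) : 1 <= a -> 0 <= b -> a + b = 1 -> a = 1 /\ b = 0 by lia.
have [k1 S00] := aux _ _ kp S0 H.
split; first by rewrite distrC.
apply/matrixP => a i; rewrite !ord1 !mxE eqxx/=.
have [->|ik] := eqVneq i k; first by rewrite mulr1; ring.
rewrite mulr0 addr0.
move/eqP: S00; rewrite psumr_eq0// => /allP/(_ i (mem_index_enum _)).
by rewrite ik/= normr_eq0 subr_eq0 => /eqP ->.
Qed.

Lemma neighbors_sym x y : neighbors x y -> neighbors y x.
Proof.
rewrite /neighbors/= => <-; apply: eq_bigr => i _; by rewrite distrC.
Qed.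

Lemma neighbors_irr x : ~ neighbors x x.
Proof.
by rewrite /neighbors/= big1// => i _; rewrite subrr normr0.
Qed.

(** The linear part of a reflection permutes the vectors +e_k and -e_k. *)
Lemma refl_unit_step d (k : 'I_N) : valid_axis d ->
  exists k' s, `|s| = 1 /\
   delta_mx 0 k - axis_form d (delta_mx 0 k) *: axis_vec d = unit_step k' s.
Proof.
case: d => [i|[[i j] b]] /=.
  move=> _; have [<-|ik] := eqVneq k i.
    exists k, (-1); split => //; rewrite mxE !eqxx /unit_step mulr1 scaleN1r.
    by rewrite -[X in X - _]scale1r -scalerBl (_ : 1 - 2 = -1) ?scaleN1r.
  exists k, 1; split => //.
  by rewrite mxE eqxx/= eq_sym (negbTE ik) mulr0 scale0r subr0 /unit_step scale1r.
move=> ij; have ij' : (i == j) = false by apply/negP => /eqP E; rewrite E ltnn in ij.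
rewrite !mxE !eqxx/=.
have [<-|ik] := eqVneq i k.
  rewrite eq_sym ij' mulr0 addr0 scale1r.
  exists j, (- (-1) ^+ b); split; first by rewrite normrN normrX normrN1 expr1n.
  by rewrite opprD addrA subrr add0r /unit_step scaleNr.
have [<-|jk] := eqVneq j k.
  exists i, (- (-1) ^+ b); split; first by rewrite normrN normrX normrN1 expr1n.
  rewrite add0r mulr1 scalerDr scalerA -expr2 sqrr_sign scale1r.
  by rewrite opprD addrCA subrr addr0 /unit_step scaleNr.
exists k, 1; split => //.
by rewrite mulr0 addr0 scale0r subr0 /unit_step scale1r.
Qed.

Lemma refl_neighbors d c x y : valid_axis d ->
  neighbors x y -> neighbors (refl d c x) (refl d c y).
Proof.
move=> vd /neighborsP[k [s [s1 ->]]].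
have [k' [s' [s1' E]]] := refl_unit_step k vd.
apply/neighborsP; exists k', (s * s'); split; first by rewrite normrM s1 s1'.
have -> : unit_step k' (s * s') =
    s *: (delta_mx 0 k - axis_form d (delta_mx 0 k) *: axis_vec d).
  by rewrite E /unit_step scalerA.
rewrite /refl axis_formD {2}/unit_step axis_formZ.
by apply/matrixP => a i; rewrite !mxE; ring.
Qed.

(** A step along e_k changes the form by at most 2, and by 2 only if the
    direction is e_k itself. An edge whose ends lie strictly on both sides is
    then orthogonal to the mirror and bisected by it. *)
Lemma refl_crossing d c x y : valid_axis d -> neighbors x y ->
  axis_form d x < c -> c < axis_form d y -> y = refl d c x.
Proof.
move=> vd /neighborsP[k [s [s1 ->]]].
rewrite axis_formD axis_formZ => xc cy.
have s2 : s = 1 \/ s = -1 by lia.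
case: d vd xc cy => [i|[[i j] b]] /= vd; rewrite !mxE !eqxx/=.
  have [<-|] := eqVneq k i; last by lia.
  move=> xc cy; have sE : s = 1 by lia.
  have -> : c = 2 * x 0 k + 1 by lia.
  by rewrite /refl/= addrAC subrr add0r sE.
have ij' : (i == j) = false by apply/negP => /eqP E; rewrite E ltnn in vd.
case: b; rewrite ?expr1 ?expr0; have [<-|] := eqVneq i k; have [//|] := eqVneq j _; try by lia.
all: by move=> E; rewrite E eqxx in ij'.
Qed.

End Geometry.

(** * Polarization *)

Section Near.
Context {N : nat}.
Implicit Types (x y : lattice N) (c : int) (d : @axis N).

(** The side of the mirror that is preferred by the rearrangement: the one that
    contains a point with form slightly above 0, in accordance with the order
    0, 1, -1, 2, -2, ... of the positions. *)
Definition near d c x : bool :=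
  if 1 <= c then axis_form d x <= c else c <= axis_form d x.

Lemma near_refl d c x : valid_axis d -> ~~ near d c x -> near d c (refl d c x).
Proof.
by move=> vd; rewrite /near axis_form_refl//; case: ifP; lia.
Qed.

Lemma Nnear_refl d c x : valid_axis d -> near d c x -> axis_form d x != c ->
  ~~ near d c (refl d c x).
Proof.
by move=> vd; rewrite /near axis_form_refl//; case: ifP; lia.
Qed.

Definition height_scale : int := 2 * N%:Z + 2.
Definition height_center (i : 'I_N) : int := N%:Z - i%:Z.
(** Squared distance, after rescaling, to a point whose coordinates are small,
    positive and strictly decreasing. Such a point lies on the preferred side
    of every mirror, so that preferred points are those closer to it than their
    reflections. *)
Definition height x : int :=
  \sum_(i < N) (height_scale * x 0 i - height_center i) ^+ 2.

Lemma height_ge0 x : 0 <= height x.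
Proof. by apply: sumr_ge0 => i _; exact: sqr_ge0. Qed.

(** The factor in the change of height under a reflection that does not depend
    on the reflected point. *)
Definition axis_slope d c : int :=
  match d with
  | inl i => height_scale * c - 2 * height_center i
  | inr ((i, j), b) => 2 * height_scale * c -
                    2 * (height_center i + (-1) ^+ b * height_center j)
  end.

Lemma height_refl d c x : valid_axis d ->
  height (refl d c x) = height x +
    height_scale * (c - axis_form d x) * axis_slope d c.
Proof.
case: d => [i|[[i j] b]] /= vd; rewrite /height.
  rewrite (bigD1 i)//= [in RHS](bigD1 i)//= !mxE !eqxx/=.
  under eq_bigr => k ki do rewrite !mxE eqxx/= (negbTE ki) mulr0 addr0.
  by ring.
have ij : (i == j) = false by apply/negP => /eqP E; rewrite E ltnn in vd.
have ji : j != i by rewrite eq_sym ij.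
rewrite (bigD1 i)//= (bigD1 j)//= [in RHS](bigD1 i)//= [in RHS](bigD1 j)//=.
rewrite !mxE !eqxx/= [j == i]eq_sym ij.
under eq_bigr => k /andP[ki kj] do
  rewrite !mxE eqxx/= (negbTE ki) (negbTE kj) mulr0 addr0 mulr0 addr0.
by case: b; rewrite ?expr0 ?expr1/=; ring.
Qed.

Lemma axis_slope_sign d c : valid_axis d ->
  if 1 <= c then 0 < axis_slope d c else axis_slope d c < 0.
Proof.
case: d => [i|[[i j] b]] /= vd;
  rewrite /height_scale /height_center.
  have := ltn_ord i; case: ifP; nia.
have := ltn_ord i; have := ltn_ord j; rewrite -subr_gt0.
by case: b; rewrite ?expr0 ?expr1; case: ifP; nia.
Qed.

Lemma height_near_lt d c x : valid_axis d -> near d c x -> axis_form d x != c ->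
  height x + 1 <= height (refl d c x).
Proof.
move=> vd; rewrite height_refl// /near.
have := axis_slope_sign c vd.
have : 0 < height_scale by rewrite /height_scale; lia.
move: height_scale (axis_slope _ _) (axis_form _ _) => M s S.
case: ifP => c1 M0 s0 Sc Sne; have h : (0 < M * (c - S) * s) by
   [rewrite pmulr_rgt0// pmulr_rgt0//; lia | rewrite -mulrA pmulr_rgt0// nmulr_rgt0//; lia].
  by lia.
by lia.
Qed.

Lemma height_near d c x : valid_axis d -> near d c x ->
  height x <= height (refl d c x).
Proof.
move=> vd nx; have [E|E] := eqVneq (axis_form d x) c; first by rewrite refl_fix.
by have := height_near_lt vd nx E; lia.
Qed.
End Near.

Section Polarization.
Context {R : realType} {N : nat}.
Implicit Types (x y : lattice N) (c : int) (d : @axis N) (u v : lattice N -> R).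

Definition pol d c u x : R :=
  if near d c x then Num.max (u x) (u (refl d c x))
  else Num.min (u x) (u (refl d c x)).

(** For a line in direction d, these inequalities for all c say that u is
    nonincreasing in the distance to the center of the line, in the order of
    the positions used by the rearrangement. *)
Definition symm u :=
  forall d c x, valid_axis d -> near d c x -> u (refl d c x) <= u x.

(** Also valid on the mirror, where both values coincide. *)
Lemma pol_near d c u x : valid_axis d -> near d c x ->
  pol d c u x = Num.max (u x) (u (refl d c x)) /\
  pol d c u (refl d c x) = Num.min (u x) (u (refl d c x)).
Proof.
move=> vd nx; rewrite /pol nx; split => //.
have [E|E] := eqVneq (axis_form d x) c.
  by rewrite !refl_fix// nx maxxx minxx.
by rewrite (negbTE (Nnear_refl vd nx E)) reflK// minC.
Qed.

Lemma pol_far d c u x : valid_axis d -> ~~ near d c x ->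
  pol d c u x = Num.min (u x) (u (refl d c x)) /\
  pol d c u (refl d c x) = Num.max (u x) (u (refl d c x)).
Proof.
move=> vd nx; have [H1 H2] := pol_near u vd (near_refl vd nx).
by move: H1 H2; rewrite reflK// minC maxC.
Qed.

Lemma pol_pair (f : R -> R) d c u x : valid_axis d ->
  f (pol d c u x) + f (pol d c u (refl d c x)) = f (u x) + f (u (refl d c x)).
Proof.
move=> vd; have [nx|nx] := boolP (near d c x).
  by have [-> ->] := pol_near u vd nx; case: leP => // _; rewrite addrC.
by have [-> ->] := pol_far u vd nx; case: leP => // _; rewrite addrC.
Qed.

Lemma pol_range d c u x : exists y, pol d c u x = u y.
Proof.
rewrite /pol; case: ifP => _; case: leP => _; by [exists x|exists (refl d c x)].
Qed.

Definition edges : set (lattice N * lattice N) := [set e | neighbors e.1 e.2].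
Definition energy p u : \bar R := \esum_(e in edges) (`|u e.2 - u e.1| `^ p)%:E.
Definition mass s u : \bar R := \esum_(x in [set: lattice N]) (`|u x| `^ s)%:E.

Lemma mass_pol s d c u : valid_axis d -> mass s (pol d c u) = mass s u.
Proof.
move=> vd.
apply: (@esum_pairing_eq _ _ _ (refl d c) _ _ (fun x => `|pol d c u x| `^ s)
  (fun x => `|u x| `^ s)) => [//|x|x|x|x _].
- exact: reflK.
- exact: powR_ge0.
- exact: powR_ge0.
- exact: (pol_pair (fun a => `|a| `^ s)).
Qed.

(** If both ends are on the same side this is the four-point inequality. If
    they are on different sides, one of them is on the mirror, and may be
    counted on either side, or the ends are exchanged by the reflection and the
    difference keeps its absolute value. *)
Lemma edge_pol p d c u x y : 1 <= p -> valid_axis d -> neighbors x y ->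
  `|pol d c u y - pol d c u x| `^ p +
  `|pol d c u (refl d c y) - pol d c u (refl d c x)| `^ p <=
  `|u y - u x| `^ p + `|u (refl d c y) - u (refl d c x)| `^ p.
Proof.
move=> p1 vd xy.
have fixE z : axis_form d z = c -> pol d c u z = u z /\ refl d c z = z.
  by move=> E; rewrite /pol refl_fix// maxxx minxx if_same.
have both a b : neighbors a b -> near d c a -> near d c b ->
  `|pol d c u b - pol d c u a| `^ p +
  `|pol d c u (refl d c b) - pol d c u (refl d c a)| `^ p <=
  `|u b - u a| `^ p + `|u (refl d c b) - u (refl d c a)| `^ p.
  move=> ab na nb.
  have [-> ->] := pol_near u vd na; have [-> ->] := pol_near u vd nb.
  exact: powR_two_point.
have bothf a b : neighbors a b -> ~~ near d c a -> ~~ near d c b ->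
  `|pol d c u b - pol d c u a| `^ p +
  `|pol d c u (refl d c b) - pol d c u (refl d c a)| `^ p <=
  `|u b - u a| `^ p + `|u (refl d c b) - u (refl d c a)| `^ p.
  move=> ab na nb.
  have [-> ->] := pol_far u vd na; have [-> ->] := pol_far u vd nb.
  rewrite addrC; exact: powR_two_point.
have mixed a b : neighbors a b -> near d c a -> ~~ near d c b ->
  `|pol d c u b - pol d c u a| `^ p +
  `|pol d c u (refl d c b) - pol d c u (refl d c a)| `^ p <=
  `|u b - u a| `^ p + `|u (refl d c b) - u (refl d c a)| `^ p.
  move=> ab na nb.
  have [E|E] := eqVneq (axis_form d a) c.
    have [-> ->] := pol_far u vd nb; have [E1 E2] := fixE a E.
    by rewrite E2 E1; case: (leP (u b) _) => // _; rewrite addrC.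
  have Eb : b = refl d c a.
    move: na nb; rewrite /near; case: ifP => c1 na nb.
      by apply: refl_crossing => //; lia.
    have -> : a = refl d c b.
      by apply: refl_crossing; rewrite ?neighbors_sym//; [exact: neighbors_sym|lia|lia].
    by rewrite reflK.
  rewrite Eb reflK//; have [-> ->] := pol_near u vd na.
  rewrite [X in X + _](_ : _ = `|u (refl d c a) - u a| `^ p); last first.
    by case: leP => // _; rewrite distrC.
  rewrite [X in _ + X](_ : _ = `|u a - u (refl d c a)| `^ p)//.
  by case: leP => // _; rewrite distrC.
have [nx|nx] := boolP (near d c x); have [ny|ny] := boolP (near d c y).
- exact: both.
- exact: mixed.
- have := mixed y x (neighbors_sym xy) ny nx.
  by rewrite (distrC (pol d c u x)) (distrC (pol d c u (refl d c x)))
     (distrC (u x)) (distrC (u (refl d c x))).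
- exact: bothf.
Qed.

Lemma energy_pol p d c u : 1 <= p -> valid_axis d ->
  (energy p (pol d c u) <= energy p u)%E.
Proof.
move=> p1 vd.
apply: (@esum_pairing_le _ _ _ (fun e => (refl d c e.1, refl d c e.2)) _ _
  (fun e => `|pol d c u e.2 - pol d c u e.1| `^ p)
  (fun e => `|u e.2 - u e.1| `^ p)) => [[x y]|[x y]|e|e|[x y]] /=.
- by move=> xy; exact: refl_neighbors.
- by rewrite !reflK.
- exact: powR_ge0.
- exact: powR_ge0.
- exact: edge_pol.
Qed.

Lemma pol_ge0 d c u : (forall x, 0 <= u x) -> forall x, 0 <= pol d c u x.
Proof. by move=> u0 x; have [y ->] := pol_range d c u x. Qed.

(** The quantity that strictly decreases in a nontrivial polarization: larger
    values move to points of smaller height. *)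
Definition potential v : \bar R :=
  \esum_(x in [set: lattice N]) (v x * (height x)%:~R)%:E.

(** The exchanged values differ by at least g, and the heights, being integers,
    by at least 1. *)
Lemma potential_pol v d c x0 (g : R) : valid_axis d -> (forall x, 0 <= v x) ->
  near d c x0 -> v x0 < v (refl d c x0) -> 0 <= g <= v (refl d c x0) - v x0 ->
  (potential (pol d c v) + g%:E <= potential v)%E.
Proof.
move=> vd v0 nx0 lt /andP[g0 gle].
have -> : g%:E = \esum_(x in [set: lattice N]) (if x == x0 then g else 0 : R)%:E.
  rewrite (@esumT_fset _ _ _ [fset x0]%fset).
  - by rewrite big_seq_fset1 eqxx.
  - by move=> x; rewrite inE => /negbTE ->.
  - by move=> x; case: ifP.
have h0 x : 0 <= (height x)%:~R :> R by rewrite ler0z height_ge0.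
rewrite /potential -esumD.
- apply: (@esum_pairing_le _ _ _ (refl d c) _ _
   (fun x => pol d c v x * (height x)%:~R + (if x == x0 then g else 0))
   (fun x => v x * (height x)%:~R)) => [//|x|x|x|x _].
  + exact: reflK.
  + by rewrite addr_ge0 ?mulr_ge0 ?pol_ge0//; case: ifP.
  + by rewrite mulr_ge0.
  wlog nx : x / near d c x.
    move=> W; have [nx|nx] := boolP (near d c x); first exact: W.
    have := W _ (near_refl vd nx); rewrite reflK// => W'.
    by rewrite addrC [leRHS]addrC.
  have [-> ->] := pol_near v vd nx.
  have Hle : (height x)%:~R <= (height (refl d c x))%:~R :> R.
    by rewrite ler_int height_near.
  have neq0 : axis_form d x0 != c.
    by apply/eqP => E; move: lt; rewrite refl_fix// ltxx.
  have nrx : refl d c x != x0.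
    apply/eqP => E; move: (Nnear_refl vd nx0 neq0).
    by rewrite -E reflK// nx.
  rewrite (negbTE nrx) addr0.
  case: eqP => [->|_]; last first.
    by rewrite addr0; case: (leP (v x) _) => H; nra.
  rewrite (max_r (ltW lt)) (min_l (ltW lt)).
  have : (height x0)%:~R + 1 <= (height (refl d c x0))%:~R :> R.
    by rewrite -(intrD _ _ 1) ler_int height_near_lt.
  move=> hh.
  have : 0 <= (v (refl d c x0) - v x0) *
    ((height (refl d c x0))%:~R - (height x0)%:~R - 1).
    by apply: mulr_ge0; lra.
  by lra.
- by move=> x _; rewrite lee_fin mulr_ge0 ?pol_ge0.
- by move=> x _; rewrite lee_fin; case: ifP.
Qed.

End Polarization.

(** * Symmetrization of finitely supported functions *)

Section Symmetrization.
Context {R : realType} {N : nat}.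
Implicit Types (u v : lattice N -> R).

Lemma seq_pos_gap (s : seq R) :
  exists2 g : R, 0 < g & forall a, a \in s -> 0 < a -> g <= a.
Proof.
elim: s => [|a s [g g0 H]]; first by exists 1.
exists (if 0 < a then Num.min g a else g).
  by case: ifP => // a0; rewrite lt_min g0.
move=> b /[!inE] /predU1P[-> b0|bs b0]; first by rewrite b0 ge_min lexx orbT.
by case: ifP => _; rewrite ?ge_min H.
Qed.

(** A finitely supported function takes finitely many values. *)
Lemma range_gap u : finitely_supported u ->
  exists2 g : R, 0 < g & forall x y, u x < u y -> g <= u y - u x.
Proof.
move=> fu.
pose vals := 0 :: [seq u x | x <- fset_set [set x | u x != 0]].
have valsP x : u x \in vals.
  rewrite inE; have [//|ux0] := eqVneq (u x) 0; apply/orP; right.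
  by apply/mapP; exists x => //; rewrite in_fset_set// inE.
have [g g0 H] := seq_pos_gap [seq b - a | a <- vals, b <- vals].
exists g => // x y xy; apply: H; last by rewrite subr_gt0.
by apply/allpairsP; exists (u x, u y); split; rewrite ?valsP.
Qed.

Lemma finitely_supported_pol (d : axis) c u : finitely_supported u ->
  valid_axis d -> finitely_supported (pol d c u).
Proof.
move=> fu vd.
apply: (@sub_finite_set _ _ ([set x | u x != 0] `|`
   refl d c @` [set x | u x != 0])); last first.
  by rewrite finite_setU; split => //; exact: finite_image.
move=> x /=; rewrite /pol => H.
have [ux|ux] := eqVneq (u x) 0; last by left.
right; exists (refl d c x); last by rewrite reflK.
apply: contra_neq H => /= E.
by rewrite ux E maxxx minxx if_same.
Qed.

(** Polarizing preserves the range, hence the gap g between values; so the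
    potential drops by at least g each time, and n polarizations exhaust a
    potential of at most n g. *)
Lemma symmetrize_bounded p u (g : R) : 1 <= p -> 0 < g ->
  (forall x, 0 <= u x) -> (forall x y, u x < u y -> g <= u y - u x) ->
  forall n v, (forall x, exists y, v x = u y) -> finitely_supported v ->
  (potential v <= (n%:R * g)%:E)%E ->
  exists w : lattice N -> R, [/\ forall x, 0 <= w x, finitely_supported w, symm w,
    (energy p w <= energy p v)%E & forall s, mass s w = mass s v].
Proof.
move=> p1 g0 u0 gap; elim=> [|n IH] v rv fv Hv.
all: have v0 x : 0 <= v x by have [y ->] := rv x.
all: have [sv|nsv] := pselect (symm v); first by exists v; split.
all: have [d [c [x [vd nx lt]]]] : exists d c x,
  [/\ valid_axis d, near d c x & v x < v (refl d c x)].
all: try (apply: contrapT => H; apply: nsv => d c x vd nx; rewrite leNgt;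
          apply/negP => lt; apply: H; by exists d, c, x).
all: have gx : g <= v (refl d c x) - v x
  by move: lt; have [y ->] := rv x; have [z ->] := rv (refl d c x); exact: gap.
all: have := @potential_pol R N v d c x g vd v0 nx lt _;
     rewrite (ltW g0) gx => /(_ isT) Hp.
- have pp : (0 <= potential (pol d c v))%E.
    by apply: esum_ge0 => y _; rewrite lee_fin mulr_ge0 ?pol_ge0// ler0z height_ge0.
  have : (g%:E <= 0)%E.
    by apply: (le_trans _ (le_trans Hp _)); rewrite ?leeDr// (le_trans Hv)// mul0r.
  by rewrite lee_fin leNgt g0.
- have [||w [w0 fw sw Ew mw]] := IH (pol d c v) _ (finitely_supported_pol c fv vd).
  + move=> y; have [z ->] := pol_range d c v y; exact: rv.
  + move: (le_trans Hp Hv); rewrite -leeBrDr// -EFinB.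
    by rewrite mulrS mulrDl mul1r [g + _]addrC addrK.
  exists w; split => //; first exact: (le_trans Ew (energy_pol _ _ p1 vd)).
  by move=> s; rewrite mw mass_pol.
Qed.

(** The Polya-Szego inequality together with the existence of a symmetric
    rearrangement. *)
Lemma symmetrize p u : 1 <= p -> (forall x, 0 <= u x) -> finitely_supported u ->
  exists w : lattice N -> R, [/\ forall x, 0 <= w x, finitely_supported w, symm w,
    (energy p w <= energy p u)%E & forall s, mass s w = mass s u].
Proof.
move=> p1 u0 fu; have [g g0 gap] := range_gap fu.
pose F := fset_set [set x | u x != 0].
pose P := \sum_(x <- F) u x * (height x)%:~R.
have EP : potential u = P%:E.
  apply: esumT_fset => x; last by rewrite mulr_ge0// ler0z height_ge0.
  by rewrite in_fset_set// notin_setE/= => /negP; rewrite negbK => /eqP ->; rewrite mul0r.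
apply: (symmetrize_bounded p1 g0 u0 gap (n := Num.bound (P / g))) => //.
  by move=> x; exists x.
rewrite EP lee_fin -ler_pdivrMr//.
have P0 : 0 <= P / g.
  rewrite divr_ge0 ?(ltW g0)// sumr_ge0// => x _.
  by rewrite mulr_ge0// ler0z height_ge0.
by rewrite ltW// archi_boundP.
Qed.

End Symmetrization.

(** * Comparison of values of a symmetric function *)

Section Comparison.
Context {R : realType} {N : nat}.
Implicit Types (u : lattice N -> R) (x y z : lattice N).

(** Two points of a line are exchanged by the reflection of that line in their
    midpoint, and the hypothesis says that x is on the preferred side. *)
Lemma symm_move u (d : axis) x (t : int) : symm u -> valid_axis d ->
  `|2 * axis_form d x - 1| <= `|2 * axis_form d x + 4 * t - 1| ->
  u (x + t *: axis_vec d) <= u x.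
Proof.
move=> su vd H.
have [->|t0] := eqVneq t 0; first by rewrite scale0r addr0.
have := su d (axis_form d x + t) x vd.
rewrite /refl [X in X *: _](_ : _ = t); last by ring.
apply; rewrite /near.
by move: (axis_form d x) H => S H; case: ifP; lia.
Qed.

Definition upd x (i : 'I_N) (a : int) : lattice N :=
  \row_k (if k == i then a else x 0 k).

Lemma symm_upd u x i a : symm u -> `|4 * a - 1| <= `|4 * x 0 i - 1| ->
  u x <= u (upd x i a).
Proof.
move=> su H.
have E : x = upd x i a + (x 0 i - a) *: axis_vec (inl i).
  apply/rowP => k; rewrite !mxE eqxx/=.
  case: (eqVneq k i) => [->|_] /=; last by rewrite mulr0 addr0.
  by rewrite mulr1; ring.
rewrite {1}E; apply: symm_move => //=; rewrite mxE eqxx.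
by move: (x 0 i) H => b H; lia.
Qed.

Lemma symm_row u x (f : 'I_N -> int) : symm u ->
  (forall k, `|4 * f k - 1| <= `|4 * x 0 k - 1|) -> u x <= u (\row_k f k).
Proof.
move=> su H.
have Hs (s : seq 'I_N) : u x <= u (\row_k (if k \in s then f k else x 0 k)).
  elim: s => [|k s IH].
    have -> // : \row_k (if k \in [::] then f k else x 0 k) = x.
    by apply/rowP => k; rewrite mxE.
  apply: (le_trans IH).
  have -> : \row_j (if j \in k :: s then f j else x 0 j) =
    upd (\row_j (if j \in s then f j else x 0 j)) k (f k).
    by apply/rowP => j; rewrite !mxE inE; case: eqP => [->|].
  by apply: symm_upd => //; rewrite mxE; case: ifP => _.
have := Hs (enum 'I_N); congr (is_true (_ <= u _)).
by apply/rowP => k; rewrite !mxE mem_enum.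
Qed.

(** The move along a diagonal direction: it lowers the large coordinate i by
    |a| while it raises the coordinate j from 0 to a. *)
Lemma symm_spread1 u z (i j : 'I_N) (a : int) : symm u -> i != j ->
  z 0 j = 0 -> 2 * `|a| + 1 <= z 0 i ->
  u z <= u (\row_k (if k == i then z 0 i - `|a| else if k == j then a else z 0 k)).
Proof.
move=> su ij zj zi; set z' := \row_k _.
(* The sign of a decides which of the two diagonal directions is used. *)
have sg : (-1) ^+ (0 <= a)%R * `|a| = - a.
  by case: (leP 0 a) => a0 /=; rewrite ?expr1 ?expr0; lia.
have sg' : (-1) ^+ (0 <= a)%R * a = - `|a|.
  by case: (leP 0 a) => a0 /=; rewrite ?expr1 ?expr0; lia.
have ij' := negbTE ij; have ji' : (j == i) = false by rewrite eq_sym.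
have := ltn_neqAle i j; have := ltn_neqAle j i.
case: (ltngtP i j) => [lt _ _|lt _ _|/val_inj E]; last by rewrite E eqxx in ij.
- have E : z = z' + `|a| *: axis_vec (inr ((i, j), (0 <= a)%R)).
    apply/rowP => k; rewrite !mxE eqxx/=.
    case: (eqVneq k i) => [->|ki] /=; first by rewrite ij' mulr0 addr0; ring.
    case: (eqVneq k j) => [->|kj] /=; last by rewrite mulr0 addr0; ring.
    by rewrite zj mulr1 add0r mulrC sg; ring.
  rewrite {1}E; apply: symm_move => //=.
  by rewrite !mxE !eqxx ji' sg'; lia.
- have E : z = z' + (- a) *: axis_vec (inr ((j, i), (0 <= a)%R)).
    apply/rowP => k; rewrite !mxE eqxx/=.
    case: (eqVneq k i) => [->|ki] /=.
      by rewrite ij' mulr1 add0r mulNr mulrC sg'; ring.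
    case: (eqVneq k j) => [->|kj] /=; last by rewrite mulr0 addr0; ring.
    by rewrite zj mulr0 addr0; ring.
  rewrite {1}E; apply: symm_move => //=.
  rewrite !mxE !eqxx ji'; move: zi; move: (z 0 i) => b.
  by case: (leP 0 a) => a0 /=; rewrite ?expr1 ?expr0; lia.
Qed.

(** Starting from a point far out on the axis i, the diagonal moves give all
    other coordinates the values that they have at y. *)
Lemma symm_spread u (i : 'I_N) (L : int) (y : lattice N) : symm u ->
  2 * (\sum_j `|y 0 j|) < L ->
  forall s : seq 'I_N, uniq s -> i \notin s ->
  u (\row_k (if k == i then L else 0)) <=
  u (\row_k (if k == i then L - \sum_(j <- s) `|y 0 j| else if k \in s then y 0 k else 0)).
Proof.
move=> su HL; elim=> [|j s IH].
  move=> _ _; rewrite le_eqVlt; apply/orP; left; apply/eqP; congr (u _); apply/rowP => k.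
  by rewrite !mxE big_nil subr0 in_nil.
move=> /= /andP[js us]; rewrite inE negb_or => /andP[ij is_].
apply: (le_trans (IH us is_)); set z := \row_k _.
have bnd : \sum_(k <- j :: s) `|y 0 k| <= \sum_k `|y 0 k|.
  rewrite big_uniq/= ?js//.
  by rewrite [leRHS](bigID (mem (j :: s)))/= lerDl sumr_ge0.
have s0 : 0 <= \sum_(k <- s) `|y 0 k| by apply: sumr_ge0.
have zi : z 0 i = L - \sum_(j <- s) `|y 0 j| by rewrite mxE eqxx.
have := @symm_spread1 u z i j (y 0 j) su ij.
rewrite mxE (negbTE js) eq_sym (negbTE ij) => /(_ erefl).
rewrite zi; move: bnd; rewrite big_cons => bnd.
move=> /(_ _); set w := \row_k _ => H.
have aux (A B a l : int) : 2 * A < l -> 0 <= B -> a + B <= A -> 0 <= a ->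
  2 * a + 1 <= l - B by lia.
apply: (le_trans (H (aux _ _ _ _ HL s0 bnd (normr_ge0 _)))).
rewrite le_eqVlt; apply/orP; left; apply/eqP; congr (u _).
apply/rowP => k; rewrite !mxE in_cons; case: eqP => [_|ki]; first by ring.
case: eqP => [->//|_] /=.
by [].
Qed.

(** One coordinate of x dominates y. Move x onto the corresponding axis, spread
    the mass to the coordinates of y other than i, and correct the coordinate
    i; none of these steps decreases u. *)
Lemma symm_le u x y : symm u ->
  (exists i, 2 * (\sum_j `|y 0 j|) < `|x 0 i|) -> u x <= u y.
Proof.
move=> su [i Hi].
apply: (le_trans (symm_row (f := fun k => if k == i then `|x 0 i| else 0) su _)).
  by move=> k; case: eqP => [->|_]; move: (x 0 _) => a; lia.
pose s := [seq k <- enum 'I_N | k != i].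
apply: (le_trans (symm_spread su Hi (s := s) _ _)).
- by rewrite filter_uniq// enum_uniq.
- by rewrite mem_filter eqxx.
set z := \row_k _.
have -> : y = upd z i (y 0 i).
  apply/rowP => k; rewrite !mxE; case: eqP => [->//|/eqP ki].
  by rewrite mem_filter ki mem_enum.
apply: symm_upd => //; rewrite mxE eqxx.
move: Hi; rewrite big_filter big_enum_cond/= (bigD1 i)//=.
have : 0 <= \sum_(k < N | k != i) `|y 0 k| by apply: sumr_ge0.
by move: (\sum_(k < N | k != i) _) (x 0 i) (y 0 i) => S a b; lia.
Qed.

Lemma symm_far u x y (m : nat) : symm u ->
  (forall j, `|y 0 j| <= m%:Z) -> (exists i, 2 * N%:Z * m%:Z < `|x 0 i|) -> u x <= u y.
Proof.
move=> su ym [i Hi]; apply: symm_le => //; exists i.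
apply: le_lt_trans Hi; rewrite -mulrA ler_pM2l//.
apply: (le_trans (ler_sum _ (fun j _ => ym j))).
by rewrite sumr_const card_ord -mulr_natl natz.
Qed.

End Comparison.

(** * Symmetric functions are their own Schwarz rearrangement *)

Section Listing.
Context {R : realType} {T : Type}.

(** If f k > g k, the first k + 1 points of the listing f carry values above g
    k, which is at least 0. They all occur among the first k points of the
    listing g, which contradicts injectivity. *)
Lemma decreasing_listing_le (V : set T) (u : T -> R) (f g : nat -> R) k :
  (forall x, 0 <= u x) ->
  decreasing_listing V u f -> decreasing_listing V u g -> f k <= g k.
Proof.
move=> u0 [s [[injs Vs] fs df _]] [s' [[injs' Vs'] gs dg cov]].
rewrite leNgt; apply/negP => lt.
have Hi i : (i <= k)%N -> exists j, s' j = s i /\ (j < k)%N.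
  move=> ik; have fik := df _ _ ik.
  have [j Ej] : exists j, s' j = s i.
    apply: cov => //; rewrite -fs; apply: lt_le_trans fik.
    by apply: le_lt_trans lt; rewrite gs.
  exists j; split => //; rewrite ltnNge; apply/negP => kj.
  have := dg _ _ kj; rewrite [g j]gs Ej -fs => /(le_trans fik).
  by rewrite leNgt lt.
have Hc (i : 'I_k.+1) : {j : 'I_k | s' j = s i}.
  apply: cid; have [|j [E jk]] := Hi i; first by rewrite -ltnS.
  by exists (Ordinal jk).
have : injective (fun i => sval (Hc i)).
  move=> i j E; apply/val_inj/injs.
  by rewrite -(svalP (Hc i)) -(svalP (Hc j)) E.
by move=> /leq_card; rewrite !card_ord ltnn.
Qed.

Lemma decreasing_valuesE (V : set T) (u : T -> R) (f : nat -> R) :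
  (forall x, 0 <= u x) -> decreasing_listing V u f -> decreasing_values V u = f.
Proof.
move=> u0 Hf; have Hg : decreasing_listing V u (decreasing_values V u).
  by apply: (@getPex _ [set f | decreasing_listing V u f]); exists f.
apply/funext => k; apply/eqP; rewrite eq_le.
by rewrite (decreasing_listing_le k u0 Hg Hf) (decreasing_listing_le k u0 Hf Hg).
Qed.

End Listing.

Section Fixed.
Context {R : realType} {N : nat}.
Implicit Types (u : lattice N -> R) (x y z : lattice N).

Definition dir_of (d : @axis N) : 'rV[rat]_N :=
  match d with
  | inl i => unit_vec i
  | inr ((i, j), b) => 2^-1 *: (unit_vec i + (-1) ^+ b *: unit_vec j)
  end.

Lemma directionsP (e : 'rV[rat]_N) : e \in directions ->
  exists2 d, valid_axis d & e = dir_of d.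
Proof.
rewrite /directions !mem_cat => /or3P[] /mapP[ij +] ->.
- by move=> _; exists (inl ij).
- rewrite mem_filter => /andP[lt _]; exists (inr (ij.1, ij.2, true)) => //=.
  by rewrite expr1 scaleN1r.
- rewrite mem_filter => /andP[lt _]; exists (inr (ij.1, ij.2, false)) => //=.
  by rewrite expr0 scale1r.
Qed.

Lemma dir_coordE (d : axis) x : 2 * dir_coord (dir_of d) x = (axis_form d x)%:~R.
Proof.
have delta (i : 'I_N) : dir_coord (unit_vec i) x = (x 0 i)%:~R.
  rewrite /dir_coord (bigD1 i)//= big1 ?addr0; first by rewrite !mxE !eqxx mul1r.
  by move=> k ki; rewrite !mxE (negbTE ki) andbF mul0r.
have dirZ a (e : 'rV_N) : dir_coord (a *: e) x = a * dir_coord e x.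
  by rewrite /dir_coord mulr_sumr; apply: eq_bigr => k _; rewrite mxE mulrA.
have dirD (e f : 'rV_N) : dir_coord (e + f) x = dir_coord e x + dir_coord f x.
  by rewrite /dir_coord -big_split; apply: eq_bigr => k _; rewrite mxE mulrDl.
case: d => [i|[[i j] b]] /=; first by rewrite delta intrM.
rewrite dirZ dirD dirZ !delta mulrA divff// mul1r.
by rewrite intrD intrM; case: b; rewrite ?expr0 ?expr1.
Qed.

Lemma axis_vec_dir (d : axis) : valid_axis d -> exists (k : rat) (i : 'I_N),
  [/\ k != 0, map_mx intr (axis_vec d) = k *: dir_of d & axis_vec d 0 i = 1].
Proof.
case: d => [i|[[i j] b]] /= vd.
  exists 1, i; split => //; last by rewrite mxE !eqxx.
  by rewrite scale1r /unit_vec; apply/rowP => k; rewrite !mxE eqxx; case: (k == i).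
have ij : (i == j) = false by apply/negP => /eqP E; rewrite E ltnn in vd.
exists 2, i; split => //; last by rewrite !mxE !eqxx/= ij mulr0.
rewrite scalerA divff// scale1r /unit_vec; apply/rowP => k; rewrite !mxE eqxx.
by case: b; rewrite ?expr0 ?expr1; case: (k == i); case: (k == j).
Qed.

(** A rational multiple of e that is a lattice vector is an integer multiple of
    [axis_vec d], because the latter has a coordinate equal to 1. *)
Lemma dir_classP (d : axis) x y : valid_axis d ->
  dir_class (dir_of d) x y <-> exists t : int, y = x + t *: axis_vec d.
Proof.
move=> vd; have [k [i [k0 Ek wi]]] := axis_vec_dir vd; split; last first.
  move=> [t ->]; exists (- t%:~R * k).
  rewrite opprD addrA subrr add0r -scalerA -Ek.
  by apply/rowP => j; rewrite !mxE rmorphN rmorphM mulNr.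
move=> [t Et]; exists (- (x - y) 0 i).
have E2 : map_mx intr (x - y) = (t / k) *: (map_mx intr (axis_vec d) : 'rV[rat]_N).
  by rewrite Ek scalerA divfK.
have Ei : t / k = ((x - y) 0 i)%:~R.
  by move/rowP: E2 => /(_ i); rewrite !mxE wi mulr1 => ->.
apply/rowP => j; move/rowP: E2 => /(_ j); rewrite Ei !mxE => E.
have : x 0 j - y 0 j = (x 0 i - y 0 i) * axis_vec d 0 j.
  by apply: (@intr_inj rat); rewrite E intrM.
by move=> H; rewrite mulNr -H; ring.
Qed.

(** [star_index] in terms of the doubled coordinate S. *)
Definition form_index (S : int) : nat := if S <= 0 then `|1 - S|%N else `|S|%N.

Lemma star_indexE (s : rat) (S : int) : 2 * s = S%:~R -> star_index s = form_index S.
Proof.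
move=> E; rewrite /star_index /form_index E.
have -> : (s <= 0) = (S <= 0).
  by rewrite -(ler_int rat) -E; apply/idP/idP; lra.
case: ifP => S0.
  have -> : 1 - S%:~R = (`|1 - S|%N)%:R :> rat.
    by rewrite pmulrn gez0_abs ?intrB//; lia.
  by rewrite Num.Theory.natrK.
have -> : S%:~R = (`|S|%N)%:R :> rat by rewrite pmulrn gez0_abs//; lia.
by rewrite Num.Theory.natrK.
Qed.

(** Inverse of [form_index] among the integers of the parity of S0. *)
Definition index_form (S0 : int) (k : nat) : int :=
  if (k.+1%:Z %% 2)%Z == (S0 %% 2)%Z then k.+1%:Z else 1 - k.+1%:Z.

Lemma form_indexK (S0 : int) k : form_index (index_form S0 k) = k.+1.
Proof. by rewrite /form_index /index_form; do 2 case: ifP; lia. Qed.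

Lemma index_form_parity (S0 : int) k :
  2 * ((index_form S0 k - S0) %/ 2)%Z = index_form S0 k - S0.
Proof. by rewrite /index_form; case: ifP; lia. Qed.

Lemma index_formK (S0 t : int) :
  index_form S0 (form_index (S0 + 2 * t)).-1 = S0 + 2 * t.
Proof. by rewrite /form_index /index_form; do 2 case: ifP; lia. Qed.

Lemma symm_listing u (d : axis) x : symm u -> valid_axis d ->
  (forall x, 0 <= u x) ->
  decreasing_listing (dir_class (dir_of d) x) u
  (fun k => u (x + ((index_form (axis_form d x) k - axis_form d x) %/ 2)%Z *: axis_vec d)).
Proof.
move=> su vd u0; set S := axis_form d x.
pose t k := ((index_form S k - S) %/ 2)%Z.
have F k : axis_form d (x + t k *: axis_vec d) = index_form S k.
  by rewrite axis_formD axis_formZ axis_form_vec// mulrC index_form_parity -/S; ring.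
exists (fun k => x + t k *: axis_vec d); split => //.
- split; last by move=> k; apply/dir_classP => //; exists (t k).
  move=> k l E; have := F k; rewrite E F => E2.
  by have := form_indexK S k; rewrite -E2 form_indexK => -[].
- move=> k l kl.
  have -> : x + t l *: axis_vec d =
     (x + t k *: axis_vec d) + (t l - t k) *: axis_vec d.
    by rewrite scalerBl addrACA subrr addr0.
  apply: symm_move => //; rewrite F.
  have := index_form_parity S k; have := index_form_parity S l.
  rewrite -!/(t _); move: (t k) (t l) => a b.
  by rewrite /index_form; do 2 case: ifP; lia.
- move=> y /(dir_classP _ _ vd)[s ->] _; exists (form_index (S + 2 * s)).-1.
  congr (_ + _ *: _); have := index_form_parity S (form_index (S + 2 * s)).-1.
  by rewrite index_formK /t index_formK; lia.
Qed.

Lemma symm_one_step u (e : 'rV[rat]_N) : symm u -> (forall x, 0 <= u x) ->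
  e \in directions -> one_step e u = u.
Proof.
move=> su u0 /directionsP[d vd ->]; apply/funext => x.
rewrite /one_step (decreasing_valuesE u0 (symm_listing x su vd u0)).
rewrite (star_indexE (dir_coordE d x)).
have := index_formK (axis_form d x) 0; rewrite mulr0 addr0 => ->.
by rewrite subrr div0z scale0r addr0.
Qed.

(** The iteration that defines the Schwarz rearrangement is constant. *)
Lemma symm_schwarz u : (0 < N)%N -> symm u -> C0plus u -> schwarz_symmetric u.
Proof.
move=> N0 su Cu; split=> //; have [u0 _] := Cu.
have sz : (0 < size (directions : seq 'rV[rat]_N))%N.
  by rewrite size_cat size_map size_enum_ord addn_gt0 N0.
have E k : iter_steps k u = u.
  elim: k => //= k ->; apply: symm_one_step => //.
  by rewrite mem_nth// ltn_mod.
apply/funext => x; rewrite /schwarz.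
by under eq_fun do rewrite E; rewrite lim_cst.
Qed.

End Fixed.

(** * Decay of symmetric functions *)

Lemma sum_const_fset {R : realType} {T : choiceType} (A : {fset T}) (c : R) :
  \sum_(x <- A) c = #|` A|%:R * c.
Proof. by rewrite big_const_seq count_predT iter_addr_0 mulr_natl. Qed.

Section Box.
Context {N : nat}.
Implicit Types (x y z : lattice N) (m : nat).

Definition box_point m (t : {ffun 'I_N -> 'I_(2 * m).+1}) : lattice N :=
  \row_i ((t i)%:Z - m%:Z).

Lemma box_point_inj m : injective (@box_point m).
Proof.
move=> s t /rowP E; apply/ffunP => i; apply/val_inj => /=.
by move: (E i); rewrite !mxE; lia.
Qed.

Definition box m : {fset lattice N} :=
  [fset @box_point m t | t in {: {ffun 'I_N -> 'I_(2 * m).+1}}]%fset.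

Lemma boxP m x : reflect (forall i, `|x 0 i| <= m%:Z) (x \in box m).
Proof.
apply: (iffP (imfsetP _ _ _ _)) => [[t _ ->] i|H].
  rewrite mxE; have := ltn_ord (t i); move: (nat_of_ord (t i)) => a.
  lia.
have Hi i : (`|(x 0 i + m%:Z)%R| < (2 * m).+1)%N by have := H i; lia.
exists [ffun i => Ordinal (Hi i)] => //.
by apply/rowP => i; rewrite mxE ffunE /=; have := H i; lia.
Qed.

Lemma card_box m : #|` box m| = ((2 * m).+1 ^ N)%N.
Proof.
rewrite card_imfset/=; last exact: box_point_inj.
by rewrite -cardE card_ffun !card_ord.
Qed.

Lemma NboxP m x : x \notin box m -> exists i, m%:Z < `|x 0 i|.
Proof.
move=> /boxP H; apply: contrapT => /forallNP nH; apply: H => i.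
by have /negP := nH i; rewrite -leNgt.
Qed.

Lemma box_subset m m' : (m <= m')%N -> (box m `<=` box m')%fset.
Proof.
move=> mm; apply/fsubsetP => x /boxP H; apply/boxP => i.
by apply: le_trans (H i) _; rewrite lez_nat.
Qed.

Lemma fset_box (F : {fset lattice N}) : exists m, (F `<=` box m)%fset.
Proof.
exists (\max_(x <- F) \max_(i < N) absz (x 0%R i)).
apply/fsubsetP => x xF; apply/boxP => i.
rewrite -abszE lez_nat.
apply: (@leq_trans (\max_(i < N) absz (x 0%R i))); first exact: leq_bigmax_cond.
by apply: (@leq_bigmax_seq _ _ _ (fun x : lattice N => \max_(i < N) absz (x 0%R i))).
Qed.
End Box.

Section Decay.
Context {R : realType} {n : nat}.
Notation N := n.+1.
Implicit Types (u : lattice N -> R) (x y z : lattice N) (m l k : nat).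

Definition ray (k : int) : lattice N := k *: delta_mx 0 0.

Lemma ray0 k : ray k 0 0 = k.
Proof. by rewrite !mxE !eqxx mulr1. Qed.

Lemma ray_norm (k : nat) i : `|ray k%:Z 0 i| <= k%:Z.
Proof.
by rewrite !mxE eqxx/=; case: eqP => _; rewrite ?mulr1 ?mulr0 ?normr0// ger0_norm.
Qed.

(** All points of the cube have values at least u x. *)
Lemma mass_decay (r : R) u x m (B : R) : 0 < r -> symm u ->
  (forall x, 0 <= u x) -> (exists i, 2 * N%:Z * m%:Z < `|x 0 i|) ->
  (mass r u <= B%:E)%E ->
  u x <= (B / #|` @box N m|%:R) `^ r^-1.
Proof.
move=> r0 su u0 xm HB.
have c0 : 0 < #|` @box N m|%:R :> R by rewrite card_box ltr0n expn_gt0.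
have H : #|` @box N m|%:R * u x `^ r <= B.
  rewrite -lee_fin; apply: le_trans HB.
  apply: (le_trans _ (@sum_fset_esum _ _ _ _ (@box N m) _)) => //.
  rewrite lee_fin -sum_const_fset.
  rewrite big_seq [leRHS]big_seq; apply: ler_sum => y /boxP ym.
  rewrite (ger0_norm (u0 y)); apply: ge0_ler_powR; rewrite ?nnegrE ?u0 ?(ltW r0)//.
  by apply: symm_far ym xm.
rewrite -[leLHS](powRr1 (u0 x)) -[X in _ `^ X](divff (lt0r_neq0 r0)) powRrM.
apply: ge0_ler_powR; rewrite ?nnegrE ?powR_ge0 ?invr_ge0 ?(ltW r0)//.
  by rewrite divr_ge0 ?(ltW c0)//; apply: le_trans H; rewrite mulr_ge0 ?powR_ge0 ?(ltW c0).
by rewrite ler_pdivlMr// mulrC.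
Qed.

(** Either a <= s, or a^(p-1) >= s^(p-1). In [energy_decay] the parameter s is
    chosen after summation. *)
Lemma young_split (p a s : R) : 1 < p -> 0 <= a -> 0 < s ->
  a <= s + a `^ p * s `^ (1 - p).
Proof.
move=> p1 a0 s0; have [as_|sa] := leP a s.
  by rewrite (le_trans as_)// lerDl mulr_ge0 ?powR_ge0.
apply: (@le_trans _ _ (a `^ p * s `^ (1 - p))); last by rewrite lerDr ltW.
have ap : 0 < a by apply: lt_trans sa.
rewrite (_ : 1 - p = - (p - 1)); last by ring.
rewrite powRN ler_pdivlMr ?powR_gt0//.
rewrite -(mulr_powRB1 a0); last by lra.
rewrite ler_wpM2l// ge0_ler_powR ?nnegrE//; lra.
Qed.

(** Sum u y - u (y + l e) over the points y of a cube, with e the first unit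
    vector. Each term is at least u x - u z, as y is close to the origin and y
    + l e far from it. For fixed k the edges from y + k e to y + (k + 1) e are
    distinct, so their total energy is at most A. *)
Lemma energy_decay (p : R) u x z m m' l (A : R) : 1 < p -> symm u ->
  (forall x, 0 <= u x) -> (exists i, 2 * N%:Z * m%:Z < `|x 0 i|) ->
  (forall j, `|z 0 j| <= m'%:Z) -> (2 * N * m' + m < l)%N ->
  0 < A -> (energy p u <= A%:E)%E ->
  u x - u z <= 2 * l%:R * (A / #|` @box N m|%:R) `^ p^-1.
Proof.
move=> p1 su u0 xm zm ll A0 HA.
set c : R := #|` @box N m|%:R.
have c0 : 0 < c by rewrite /c card_box ltr0n expn_gt0.
(* The value that balances both terms of [young_split] after summation. *)
set s := (A / c) `^ p^-1.
have s0 : 0 < s by rewrite powR_gt0 ?divr_gt0.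
pose D y k := `|u (y + ray k.+1%:Z) - u (y + ray k%:Z)|.
have step y : y \in box m -> u x - u z <= \sum_(k < l) D y k.
  move=> /boxP ym.
  have H1 : u x <= u (y + ray 0).
    by apply: (@symm_far _ _ _ _ _ m) => // j; rewrite /ray scale0r addr0.
  have H2 : u (y + ray l%:Z) <= u z.
    apply: (@symm_far _ _ _ _ _ m') => //; exists 0.
    have ll' : 2 * N%:Z * m'%:Z + m%:Z < l%:Z by rewrite -!PoszM -PoszD ltz_nat.
    by rewrite mxE ray0; have := ym 0; move: (y 0 0) (2 * _ * _) ll' => a b; lia.
  apply: (@le_trans _ _ (u (y + ray 0) - u (y + ray l%:Z))); first by lra.
  elim: (l) => [|k IH]; first by rewrite big_ord0 subrr.
  rewrite big_ord_recr/=.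
  have : u (y + ray k%:Z) - u (y + ray k.+1%:Z) <= D y k by rewrite /D distrC ler_norm.
  by move: IH; lra.
have edgeS k : \sum_(y <- box m) D y k `^ p <= A.
  rewrite -lee_fin; apply: le_trans HA.
  (* Translates of one edge by distinct vectors are distinct. *)
  pose f y := (y + ray k%:Z, y + ray k.+1%:Z).
  have finj : injective f by move=> y y' [/addIr].
  apply: (le_trans _ (@sum_fset_esum _ _ _ (fun e => `|u e.2 - u e.1| `^ p)
    [fset f y | y in box m]%fset _)).
    by rewrite lee_fin [leRHS]big_imfset//= => y y' _ _; exact: finj.
  move=> e /imfsetP[y _ ->]; apply/neighborsP; exists 0, 1; split => //.
  rewrite /= -addrA; congr (_ + _); rewrite /ray /unit_step -scalerDl.
  by congr (_ *: _); lia.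
have H : c * (u x - u z) <= l%:R * c * s + s `^ (1 - p) * (l%:R * A).
  rewrite /c -sum_const_fset.
  apply: (@le_trans _ _ (\sum_(y <- box m) \sum_(k < l) (s + D y k `^ p * s `^ (1 - p)))).
    rewrite big_seq [leRHS]big_seq; apply: ler_sum => y yb.
    apply: (le_trans (step y yb)); apply: ler_sum => k _; apply: young_split => //; exact: normr_ge0.
  rewrite exchange_big/=.
  apply: (@le_trans _ _ (\sum_(k < l) (c * s + s `^ (1 - p) * A))).
    apply: ler_sum => k _; rewrite big_split/= sum_const_fset lerD2l.
    by rewrite -mulr_suml mulrC ler_wpM2l ?powR_ge0.
  by rewrite sumr_const card_ord -mulr_natl; lra.
have sp : s `^ p = A / c.
  by rewrite -powRrM mulVf ?powRr1 ?divr_ge0 ?(ltW A0) ?(ltW c0)//; apply/eqP; lra.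
have s1p : s `^ (1 - p) * A = s * c.
  rewrite powRB; last by rewrite (gt_eqF s0) implybT.
  rewrite powRr1 ?(ltW s0)// sp; field.
  by rewrite !gt_eqF.
rewrite -(ler_pM2l c0); apply: (le_trans H).
by rewrite mulrCA s1p; lra.
Qed.
End Decay.

(** * Uniform decay rate and tails *)

Section Rate.
Context {R : realType}.

Lemma powRD_pos (x a b : R) : 0 < x -> x `^ (a + b) = x `^ a * x `^ b.
Proof. by move=> x0; rewrite powRD// (gt_eqF x0) implybT. Qed.

(** The exponents of P on both sides agree by the relation that defines qs. *)
Lemma scaling_identity (p r theta qs nu A B P c : R) :
  0 <= theta <= 1 -> nu != 0 ->
  qs^-1 = theta * (p^-1 - nu^-1) + (1 - theta) / r ->
  0 < A -> 0 < B -> 0 < P -> 1 <= c ->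
  (c * P * (A * P `^ (- nu)) `^ p^-1) `^ theta *
  ((B * P `^ (- nu)) `^ r^-1) `^ (1 - theta) <=
  c * (A `^ (theta / p) * B `^ ((1 - theta) / r)) * P `^ (- (nu / qs)).
Proof.
move=> /andP[t0 t1] nu0 hq A0 B0 P0 c1.
have c0 : 0 < c by lra.
have Pn a : 0 <= P `^ a by exact: powR_ge0.
have E1 : (A * P `^ (- nu)) `^ p^-1 = A `^ p^-1 * P `^ (- nu / p).
  by rewrite powRM ?(ltW A0)// -powRrM.
have E2 : (B * P `^ (- nu)) `^ r^-1 = B `^ r^-1 * P `^ (- nu / r).
  by rewrite powRM ?(ltW B0)// -powRrM.
rewrite E1 E2 !powRM ?mulr_ge0 ?powR_ge0 ?(ltW c0) ?(ltW P0)// -!powRrM.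
have -> : - (nu / qs) = theta + (- nu / p * theta + - nu / r * (1 - theta)).
  by rewrite hq -[X in _ = X + _](mulr1 theta) -(divff nu0); ring.
rewrite !(powRD_pos _ _ P0) [p^-1 * _]mulrC [r^-1 * _]mulrC.
rewrite (_ : _ * _ * _ * _ = c `^ theta * (A `^ (theta / p) * B `^ ((1 - theta) / r) *
  (P `^ theta * (P `^ (- nu / p * theta) * P `^ (- nu / r * (1 - theta)))))); last by ring.
rewrite -[leRHS]mulrA ler_wpM2r ?mulr_ge0 ?powR_ge0//.
exact: ler1_powR.
Qed.

End Rate.

Section Tail.
Context {R : realType} {n : nat}.
Notation N := n.+1.
Implicit Types (u : lattice N -> R) (x y z : lattice N) (m l k : nat).
Variables (p r theta q qs : R).
Hypotheses (hp : 1 < p) (hr : 1 < r) (ht : 0 <= theta <= 1).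
Hypothesis (hqs : qs^-1 = theta * (p^-1 - N%:R^-1) + (1 - theta) / r).
Hypotheses (qs1 : 1 < qs) (hq : qs < q).

Let rho : nat := (2 * N).+1.
Let M u k := u (ray (rho ^ k)%:Z : lattice N).
Let kappa : R := rho%:R `^ (- (N%:R / qs)).
Let C0 : R := 2 * (rho ^ 3)%:R.

Lemma kappa_gt0 : 0 < kappa.
Proof. by apply: powR_gt0; rewrite ltr0n. Qed.

Lemma kappa_lt1 : kappa < 1.
Proof.
rewrite /kappa powRN invf_lt1; last by rewrite powR_gt0 ?ltr0n.
have e0 : 0 < N%:R / qs :> R by rewrite divr_gt0 ?ltr0n// (lt_trans _ qs1).
suff : (1 : R) `^ (N%:R / qs) < rho%:R `^ (N%:R / qs) by rewrite powR1.
by apply: gt0_ltr_powR; rewrite ?nnegrE ?ler0n// ltr1n.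
Qed.

Lemma ray_far k : exists i, 2 * N%:Z * (rho ^ k)%:Z < `|(ray (rho ^ k.+1)%:Z : lattice N) 0 i|.
Proof.
exists 0; rewrite ray0 ger0_norm// -!PoszM ltz_nat expnS ltn_pmul2r ?expn_gt0//.
Qed.

Lemma ray_mono u k : symm u -> M u k.+1 <= M u k.
Proof. by move=> su; apply: (symm_far su (ray_norm (rho ^ k))); exact: ray_far. Qed.

(** The increment is bounded by each of the two decay estimates, hence by their
    geometric mean. A point of norm rho^(k+1) is far from the cube of radius
    rho^k, and rho^(k+3) is a step long enough to leave the cube of radius
    rho^(k+2). *)
Lemma gap_le u k A B : symm u -> (forall x, 0 <= u x) -> 0 < A -> 0 < B ->
  (energy p u <= A%:E)%E -> (mass r u <= B%:E)%E ->
  M u k.+1 - M u k.+2 <=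
    C0 * (A `^ (theta / p) * B `^ ((1 - theta) / r)) * kappa ^+ k.
Proof.
move=> su u0 A0 B0 HA HB.
have p0 : 0 < p := lt_trans ltr01 hp; have r0 : 0 < r := lt_trans ltr01 hr.
set d := M u k.+1 - M u k.+2.
have d0 : 0 <= d by rewrite subr_ge0 ray_mono.
pose P : R := (rho ^ k)%:R.
have P0 : 0 < P by rewrite ltr0n expn_gt0.
set c : R := #|` @box N (rho ^ k)|%:R.
have c0 : 0 < c by rewrite /c card_box ltr0n expn_gt0.
have cP : c^-1 <= P `^ (- N%:R).
  rewrite powRN powR_mulrn ?(ltW P0)// lef_pV2 ?posrE ?exprn_gt0//.
  rewrite /c /P card_box -natrX ler_nat leq_exp2r//.
  by rewrite mul2n -addnn -addnS leq_addr.
have H2 : d <= (B * P `^ (- N%:R)) `^ r^-1.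
  apply: (@le_trans _ _ (M u k.+1)); first by rewrite /d gerBl u0.
  apply: (le_trans (mass_decay (lt_trans ltr01 hr) su u0 (ray_far k) HB)).
  by rewrite ge0_ler_powR ?nnegrE ?mulr_ge0 ?invr_ge0 ?powR_ge0 ?(ltW B0) ?(ltW c0)
    ?(ltW r0)// ler_pM2l.
have H1 : d <= C0 * P * (A * P `^ (- N%:R)) `^ p^-1.
  apply: (le_trans (@energy_decay _ _ p u _ (ray (rho ^ k.+2)%:Z)
    (rho ^ k) (rho ^ k.+2) (rho ^ k.+3) A hp su u0 (ray_far k) (ray_norm _) _ A0 HA)).
    have -> : (rho ^ k.+3 = 2 * N * rho ^ k.+2 + rho ^ k.+2)%N.
      by rewrite expnS {1}/rho mulSn addnC.
    by rewrite ltn_add2l ltn_exp2l.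
  have -> : C0 * P = 2 * (rho ^ k.+3)%:R by rewrite /C0 /P -mulrA -natrM -expnD.
  rewrite ler_pM2l ?mulr_gt0 ?ltr0n ?expn_gt0//.
  by rewrite ge0_ler_powR ?nnegrE ?mulr_ge0 ?invr_ge0 ?powR_ge0 ?(ltW A0) ?(ltW c0)
    ?(ltW p0)// ler_pM2l.
have -> : kappa ^+ k = P `^ (- (N%:R / qs)).
  by rewrite /kappa /P natrX -!powR_mulrn ?powR_ge0// powRAC.
have C1 : 1 <= C0 by rewrite /C0 -natrM ler1n muln_gt0 expn_gt0.
apply: (le_trans _ (scaling_identity ht _ hqs A0 B0 P0 C1)); last by rewrite pnatr_eq0.
move: ht => /andP[t0 t1].
rewrite -[d]powRr1// -{1}(subrKC theta 1).
have [->|dn] := eqVneq d 0.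
  rewrite powR0; last by rewrite subrKC oner_eq0.
  by rewrite mulr_ge0 ?powR_ge0.
rewrite powRD ?dn ?implybT//.
have H1n := le_trans d0 H1; have H2n := le_trans d0 H2.
apply: ler_pM; [exact: powR_ge0|exact: powR_ge0| |].
  by apply: ge0_ler_powR => //; rewrite nnegrE.
by apply: ge0_ler_powR; rewrite ?nnegrE// subr_ge0.
Qed.

(** With E the factor in front of kappa^k, [gap_le] says that M u k.+1 - E
    kappa^k is nondecreasing in k. It is negative for large k, because u
    vanishes far away. *)
Lemma ray_decay u k A B : symm u -> (forall x, 0 <= u x) ->
  finitely_supported u -> 0 < A -> 0 < B ->
  (energy p u <= A%:E)%E -> (mass r u <= B%:E)%E ->
  M u k.+1 <= C0 / (1 - kappa) * (A `^ (theta / p) * B `^ ((1 - theta) / r)) * kappa ^+ k.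
Proof.
move=> su u0 fu A0 B0 HA HB.
set G := _ `^ _ * _ `^ _.
have k0 := kappa_gt0; have k1 := kappa_lt1.
set E := C0 / (1 - kappa) * G.
have G0 : 0 <= G by rewrite mulr_ge0 ?powR_ge0.
have C00 : 0 <= C0 by rewrite mulr_ge0.
have E0 : 0 <= E by rewrite mulr_ge0// divr_ge0//; lra.
have H j : M u k.+1 - E * kappa ^+ k <= M u (k + j).+1 - E * kappa ^+ (k + j).
  elim: j => [|j IH]; first by rewrite addn0.
  apply: (le_trans IH); rewrite addnS.
  have := gap_le (k + j) su u0 A0 B0 HA HB; rewrite -/G exprS.
  have -> : C0 * G = E * (1 - kappa) by rewrite /E; field; lra.
  move: (E) (kappa ^+ (k + j)) => e f; lra.
have [J HJ] : exists J, M u (k + J).+1 = 0.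
  have [m Hm] := fset_box (fset_set [set x | u x != 0]).
  exists m; apply: contrapT => /eqP nz.
  have Hr : (ray (rho ^ (k + m).+1)%:Z : lattice N) \in fset_set [set x | u x != 0].
    by rewrite in_fset_set// inE.
  have := fsubsetP Hm _ Hr.
  move=> /boxP/(_ 0); rewrite ray0 ger0_norm// lez_nat leqNgt => /negP; apply.
  apply: (@leq_ltn_trans (k + m)); first by rewrite leq_addl.
  apply: (@ltn_trans (k + m).+1) => //; exact: ltn_expl.
have := H J; rewrite HJ sub0r.
have : 0 <= E * kappa ^+ (k + J) by rewrite mulr_ge0// exprn_ge0// ltW.
lra.
Qed.

Let eta : R := rho%:R ^+ N * kappa `^ q.
Let C1 : R := (3 * (rho ^ 3)%:R) ^+ N.

Lemma eta_gt0 : 0 < eta.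
Proof.
apply: mulr_gt0; first by apply: exprn_gt0; rewrite ltr0n.
exact/powR_gt0/kappa_gt0.
Qed.

(** The exponent N - N q / qs of rho is negative because q > qs. *)
Lemma eta_lt1 : eta < 1.
Proof.
have rho0 : 0 < rho%:R :> R by rewrite ltr0n.
have qs0 : 0 < qs := lt_trans ltr01 qs1.
rewrite /eta /kappa -powR_mulrn ?ler0n// -powRrM -powRD_pos//.
rewrite (_ : _ + _ = - (N%:R * (q / qs - 1))); last first.
  by rewrite -[X in X + _]mulr1 -(divff (lt0r_neq0 qs0)); field; rewrite gt_eqF.
rewrite powRN invf_lt1; last by rewrite powR_gt0.
have e0 : 0 < N%:R * (q / qs - 1) :> R.
  by rewrite mulr_gt0 ?ltr0n// subr_gt0 ltr_pdivlMr// mul1r.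
suff : (1 : R) `^ (N%:R * (q / qs - 1)) < rho%:R `^ (N%:R * (q / qs - 1)) by rewrite powR1.
by apply: gt0_ltr_powR; rewrite ?nnegrE ?ler0n// ltr1n.
Qed.

Let S u j := \sum_(x <- box (rho ^ j.+2)) `|u x| `^ q.

(** The shell between the cubes of radii rho^(j+2) and rho^(j+3) has at most C1
    rho^(j N) points, and on it u is at most E kappa^j. *)
Lemma shell_le u E j : symm u -> (forall x, 0 <= u x) -> 0 <= E ->
  (forall k, M u k.+1 <= E * kappa ^+ k) ->
  S u j.+1 <= S u j + C1 * E `^ q * eta ^+ j.
Proof.
move=> su u0 E0 HE.
have q0 : 0 < q := lt_trans (lt_trans ltr01 qs1) hq.
have sub : (box (rho ^ j.+2) `<=` @box N (rho ^ j.+3))%fset.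
  by apply: box_subset; rewrite leq_exp2l.
rewrite /S (sum_fsetUI _ sub) lerD2l.
set X := E * kappa ^+ j.
have X0 : 0 <= X by rewrite mulr_ge0// exprn_ge0// ltW// kappa_gt0.
apply: (@le_trans _ _ (\sum_(x <- (box (rho ^ j.+3) `\` box (rho ^ j.+2))%fset) X `^ q)).
  rewrite big_seq [leRHS]big_seq; apply: ler_sum => x.
  rewrite inE => /andP[/NboxP[i Hi] _].
  rewrite (ger0_norm (u0 x)) ge0_ler_powR ?nnegrE ?(ltW q0)//.
  apply: le_trans (HE j); apply: (symm_far su (ray_norm (rho ^ j.+1))).
  exists i; apply: le_lt_trans Hi.
  by rewrite -!PoszM lez_nat [leqRHS]expnS leq_pmul2r ?expn_gt0.
rewrite sum_const_fset.
apply: (@le_trans _ _ (#|` @box N (rho ^ j.+3)|%:R * X `^ q)).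
  rewrite ler_wpM2r ?powR_ge0// ler_nat fsubset_leq_card// fsubsetDl//.
have -> : X `^ q = E `^ q * (kappa `^ q) ^+ j.
  rewrite powRM ?exprn_ge0 ?(ltW kappa_gt0)//; congr (_ * _).
  by rewrite -!powR_mulrn ?powR_ge0 ?(ltW kappa_gt0)// powRAC.
rewrite /eta exprMn -exprM [(N * j)%N]mulnC exprM.
set e := E `^ q; set kq := (kappa `^ q) ^+ j.
have e0 : 0 <= e by exact: powR_ge0.
have kq0 : 0 <= kq by rewrite exprn_ge0// powR_ge0.
rewrite (_ : C1 * e * _ = C1 * (rho%:R ^+ j) ^+ N * (e * kq)); last by ring.
rewrite ler_wpM2r ?mulr_ge0//.
rewrite /C1 -exprMn card_box natrX lerXn2r ?nnegrE ?mulr_ge0 ?exprn_ge0//.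
rewrite -natrX -!natrM ler_nat.
have -> : (3 * rho ^ 3 * rho ^ j = (2 + 1) * rho ^ j.+3)%N by rewrite -mulnA -expnD.
by rewrite mulnDl mul1n -addn1 leq_add2l expn_gt0.
Qed.

Lemma mass_tail u E j : symm u -> (forall x, 0 <= u x) -> 0 <= E ->
  (forall k, M u k.+1 <= E * kappa ^+ k) ->
  (mass q u <= (S u j + C1 * E `^ q / (1 - eta) * eta ^+ j)%:E)%E.
Proof.
move=> su u0 E0 HE.
have h0 := eta_gt0; have h1 := eta_lt1.
set Q := C1 * E `^ q / (1 - eta).
have Q0 : 0 <= Q.
  by rewrite divr_ge0 ?mulr_ge0 ?powR_ge0 ?exprn_ge0 ?subr_ge0 ?(ltW h1).
have H i : S u (j + i) + Q * eta ^+ (j + i) <= S u j + Q * eta ^+ j.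
  elim: i => [|i IH]; first by rewrite addn0.
  apply: le_trans IH; rewrite addnS.
  have := shell_le (j + i) su u0 E0 HE; rewrite exprS.
  have -> : C1 * E `^ q = Q * (1 - eta) by rewrite /Q; field; rewrite gt_eqF// subr_gt0.
  move: (Q) (eta ^+ (j + i)) => e f; lra.
apply: esum_le_fset => F _; rewrite lee_fin.
have [m Hm] := fset_box F.
have sub : (F `<=` @box N (rho ^ (j + m).+2))%fset.
  apply: (fsubset_trans Hm); apply: box_subset.
  apply: (@leq_trans (j + m).+2); first by rewrite -addn2 -addnA addnCA leq_addr.
  by rewrite ltnW// ltn_expl.
apply: (le_trans (ler_sum_fsubset _ sub)); first by move=> x; exact: powR_ge0.
apply: le_trans (H m); rewrite lerDl mulr_ge0// exprn_ge0// ltW//.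
Qed.

(** The finite set depends only on the bound G, not on u. This compactness
    makes the constraint stable under limits. *)
Lemma uniform_tail (G e : R) : 0 <= G -> 0 < e -> exists F : {fset lattice N},
  forall u A B, symm u -> (forall x, 0 <= u x) -> finitely_supported u ->
   0 < A -> 0 < B -> (energy p u <= A%:E)%E -> (mass r u <= B%:E)%E ->
   A `^ (theta / p) * B `^ ((1 - theta) / r) <= G ->
   (mass q u <= (\sum_(x <- F) `|u x| `^ q + e)%:E)%E.
Proof.
move=> G0 e0; have h0 := eta_gt0; have h1 := eta_lt1.
have k0 := kappa_gt0; have k1 := kappa_lt1.
pose E := C0 / (1 - kappa) * G.
have E0 : 0 <= E.
  by rewrite mulr_ge0// divr_ge0 ?mulr_ge0 ?subr_ge0 ?(ltW k1).
pose Q := C1 * E `^ q / (1 - eta).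
have Q0 : 0 <= Q.
  by rewrite divr_ge0 ?mulr_ge0 ?powR_ge0 ?exprn_ge0 ?subr_ge0 ?(ltW h1).
have [j Hj] : exists j, Q * eta ^+ j <= e.
  have : eta ^+ j @[j --> \oo] --> (0 : R).
    by apply: cvg_expr; rewrite ger0_norm ?(ltW h0).
  move=> /cvgrPdist_lt/(_ (e / (Q + 1))) H.
  have [|j _ Hj] := H; first by rewrite divr_gt0//; lra.
  exists j; have := Hj j (leqnn _).
  rewrite sub0r normrN ger0_norm ?exprn_ge0 ?(ltW h0)// ltr_pdivlMr; last lra.
  have : 0 <= eta ^+ j by rewrite exprn_ge0 ?(ltW h0).
  move: (eta ^+ j) => f; nra.
exists (box (rho ^ j.+2)) => u A B su u0 fu A0 B0 HA HB HG.
apply: (le_trans (@mass_tail u E j su u0 E0 _)); last by rewrite lee_fin lerD2l.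
move=> k; apply: (le_trans (ray_decay k su u0 fu A0 B0 HA HB)).
rewrite ler_wpM2r ?exprn_ge0 ?(ltW k0)// ler_wpM2l//.
by rewrite divr_ge0 ?mulr_ge0 ?subr_ge0 ?(ltW k1).
Qed.

End Tail.

(** * Norms, truncation and the completion *)

Lemma cvg_sum_seq {R : realType} {T I : Type} (F : set_system T) (FF : Filter F)
  (s : seq I) (f : I -> T -> R) (a : I -> R) :
  (forall i, f i x @[x --> F] --> a i) ->
  (\sum_(i <- s) f i x) @[x --> F] --> \sum_(i <- s) a i.
Proof. by move=> H; apply: cvg_big => //; exact: add_continuous. Qed.

Section Bridge.
Context {R : realType} {N : nat}.
Implicit Types (u v : lattice N -> R) (x y : lattice N) (p q r s t theta : R).

(** Both sides sum over ordered edges. *)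
Lemma dnormE p u : dnorm p u = (energy p u `^ p^-1)%E.
Proof.
rewrite /dnorm esum_esum; last by move=> *; rewrite lee_fin powR_ge0.
rewrite /energy; congr (esum _ _ `^ _)%E.
by apply/seteqP; split => e /=; [case|split].
Qed.

Lemma energy_ge0 p u : (0 <= energy p u)%E.
Proof. by apply: esum_ge0 => e _; rewrite lee_fin powR_ge0. Qed.

Lemma mass_ge0 s u : (0 <= mass s u)%E.
Proof. by apply: esum_ge0 => e _; rewrite lee_fin powR_ge0. Qed.

Lemma lnorm_eq1 s u : 0 < s -> lnorm s u = 1%E <-> mass s u = 1%E.
Proof.
move=> s0; rewrite /lnorm -/(mass s u); split => [H|->]; last by rewrite poweR1r.
have : ((mass s u `^ s^-1) `^ s = 1)%E by rewrite H poweR1r.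
by rewrite -poweRrM mulVf ?gt_eqF// poweRe1// mass_ge0.
Qed.

Lemma gn_functionalE p r theta u : gn_functional p r theta u =
  (energy p u `^ (theta / p) * mass r u `^ ((1 - theta) / r))%E.
Proof.
by rewrite /gn_functional dnormE /lnorm -!poweRrM [theta / p]mulrC [(1 - theta) / r]mulrC.
Qed.

Lemma energy_lipschitz p u (f : R -> R) : 0 <= p ->
  (forall a b, `|f a - f b| <= `|a - b|) ->
  (energy p (f \o u) <= energy p u)%E.
Proof.
move=> p0 fl; apply: le_esum => e _; rewrite lee_fin.
by apply: ge0_ler_powR; rewrite ?nnegrE//; exact: fl.
Qed.

Lemma mass_contract s u (f : R -> R) : 0 <= s ->
  (forall a, `|f a| <= `|a|) -> (mass s (f \o u) <= mass s u)%E.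
Proof.
move=> p0 fl; apply: le_esum => e _; rewrite lee_fin.
by apply: ge0_ler_powR; rewrite ?nnegrE//; exact: fl.
Qed.

Lemma mass_levels s u t : 0 < s -> (mass s u < +oo)%E -> 0 < t ->
  finite_set [set x | t < `|u x|].
Proof.
move=> s0 fin t0; apply: contrapT => inf.
have ts0 : 0 < t `^ s by exact: powR_gt0.
move: fin (mass_ge0 s u); case E : (mass s u) => [m| |]// _; rewrite lee_fin => m0.
have [B BA cB] := infinite_set_fset (Num.bound (m / t `^ s)) inf.
have : ((\sum_(x <- B) `|u x| `^ s)%:E <= mass s u)%E by exact: sum_fset_esum.
rewrite E lee_fin leNgt => /negP; apply.
apply: (@lt_le_trans _ _ (\sum_(x <- B) t `^ s)); last first.
  rewrite big_seq [leRHS]big_seq; apply: ler_sum => x xB.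
  by apply: ge0_ler_powR; rewrite ?nnegrE ?(ltW s0) ?(ltW t0)// ltW//; exact: BA.
rewrite sum_const_fset -ltr_pdivrMr//.
apply: (@lt_le_trans _ _ (Num.bound (m / t `^ s))%:R); last by rewrite ler_nat.
by apply: archi_boundP; rewrite divr_ge0// ltW.
Qed.

Definition levels_finite u := forall t, 0 < t -> finite_set [set x | t < `|u x|].

Definition shrink (e a : R) : R := Num.max (`|a| - e) 0.

Lemma shrink_finitely_supported u e : levels_finite u -> 0 < e ->
  finitely_supported (shrink e \o u).
Proof.
move=> fu e0; apply: sub_finite_set (fu e e0) => x /=.
by rewrite /shrink; case: (leP (`|u x| - e) 0) => //; rewrite ?eqxx// subr_gt0.
Qed.

Lemma shrink_lipschitz e a b : `|shrink e a - shrink e b| <= `|a - b|.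
Proof.
have := ler_dist_dist a b; rewrite ler_norml => /andP[h1 h2].
rewrite ler_norml /shrink; have := normr_ge0 (a - b).
by case: (leP (`|a| - e) 0); case: (leP (`|b| - e) 0) => *; apply/andP; split; lra.
Qed.

(** Subtracting a small height from |u| is a contraction that leaves finitely
    many nonzero values; the loss of mass tends to 0 with the height. *)
Lemma truncation (p q : R) u (d : R) : 1 <= p -> 0 < q -> mass q u = 1%E -> 0 < d ->
  exists w : lattice N -> R, [/\ forall x, 0 <= w x, finitely_supported w,
    (energy p w <= energy p u)%E, (forall s : R, 0 <= s -> (mass s w <= mass s u)%E) &
    ((1 - d)%:E <= mass q w)%E].
Proof.
move=> p1 q0 Hq d0.
have : ((1 - d)%:E < mass q u)%E by rewrite Hq lte_fin; lra.
move=> /esum_gt_fset[F _]; rewrite lte_fin => HF.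
have fu : levels_finite u by move=> t; apply: (mass_levels q0); rewrite Hq ltry.
have : (\sum_(x <- F) `|shrink e (u x)| `^ q) @[e --> 0] -->
        \sum_(x <- F) `|u x| `^ q.
  apply: cvg_sum_seq => x.
  have -> : `|u x| `^ q = `|shrink 0 (u x)| `^ q.
    by rewrite /shrink subr0 (max_l (normr_ge0 _)) normr_id.
  have := @continuous_comp R R R (fun e => shrink e (u x)) (fun t => `|t| `^ q) 0.
  apply; last exact: continuous_norm_powR.
  apply: (@continuous_max _ _ (fun e => `|u x| - e) (fun=> 0)); last exact: cvg_cst.
  by apply: continuousB; [exact: cvg_cst|exact: cvg_id].
move=> /cvgrPdist_lt/(_ (\sum_(x <- F) `|u x| `^ q - (1 - d))).
rewrite subr_gt0 => /(_ HF) /nbhs_ballP[e /= e0 He].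
have {}He := He (e / 2) _.
exists (shrink (e / 2) \o u).
have e20 : 0 < e / 2 by lra.
split.
- by move=> x /=; rewrite /shrink le_max lexx orbT.
- exact: shrink_finitely_supported.
- apply: energy_lipschitz => [|a b]; first lra.
  exact: shrink_lipschitz.
- move=> s s0; apply: mass_contract => // a.
  rewrite /shrink; case: (leP (`|a| - e / 2) 0) => *; rewrite ?normr0//.
  by rewrite ger0_norm; lra.
- apply: (le_trans _ (@sum_fset_esum _ _ _ _ F _)) => //.
  rewrite lee_fin.
  have : ball 0 e (e / 2) by rewrite /ball/= sub0r normrN ger0_norm; lra.
  by move=> /He /=; rewrite ltr_norml => /andP[_]; lra.
Qed.

End Bridge.
Section CompletionMembership.
Context {R : realType} {N : nat}.
Implicit Types (u v : lattice N -> R) (x y : lattice N) (p q r s t theta a b e : R).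

Definition clamp e a : R := Num.max (- e) (Num.min a e).

Lemma clamp_norm e a : 0 <= e -> `|clamp e a| <= e.
Proof.
move=> e0; rewrite ler_norml /clamp.
case: (leP a e) => *.
  by case: (leP (- e) a) => *; apply/andP; split; lra.
by case: (leP (- e) e) => *; apply/andP; split; lra.
Qed.

Lemma clamp_id e a : `|a| <= e -> clamp e a = a.
Proof.
rewrite ler_norml /clamp => /andP[h1 h2].
by rewrite (min_l h2) (max_r h1).
Qed.

Lemma clamp_lipschitz e a b : 0 <= e -> `|clamp e a - clamp e b| <= `|a - b|.
Proof.
move=> e0; have n1 := ler_norm (a - b); have n2 := ler_norm (b - a).
rewrite distrC in n2; have n3 := normr_ge0 (a - b); rewrite ler_norml /clamp.
case: (leP a e) => h1; case: (leP b e) => h2.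
- by case: (leP (- e) a); case: (leP (- e) b) => *; apply/andP; split; lra.
- by case: (leP (- e) a); case: (leP (- e) e) => *; apply/andP; split; lra.
- by case: (leP (- e) b); case: (leP (- e) e) => *; apply/andP; split; lra.
- by rewrite subrr => *; apply/andP; split; lra.
Qed.

(** Dominated convergence: outside a finite set of edges the energies are
    bounded by a small tail of the energy of u, and on the finite set they tend
    to 0. *)
Lemma energy_small p u (v : nat -> lattice N -> R) : 0 < p ->
  (energy p u < +oo)%E ->
  (forall k x y, `|v k y - v k x| <= `|u y - u x|) ->
  (forall k x, `|v k x| <= k.+1%:R^-1) ->
  forall e, 0 < e -> \forall k \near \oo, (energy p (v k) <= e%:E)%E.
Proof.
move=> p0 fin lip small e e0.
have e20 : 0 < e / 2 by lra.
have [F Fe HF] := esum_tail (fun _ _ => powR_ge0 _ _) fin e20.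
pose c : R := #|` F|%:R.
have c0 : 0 <= c by rewrite ler0n.
have ec0 : 0 < e / 2 / (c + 1) by rewrite divr_gt0//; lra.
have [d d0 Hd] := near_powR_pos p0 ec0.
have d20 : 0 < d / 2 by lra.
near=> k.
have kd : k.+1%:R^-1 < d / 2 by near: k; exact: near_infty_natSinv_lt (PosNum d20).
rewrite /energy (esumID [set` F]); last by move=> i _; rewrite lee_fin powR_ge0.
have -> : edges `&` [set` F] = [set` F].
  by apply/seteqP; split => [x []//|x Fx]; split => //; exact: Fe.
rewrite esum_fset//.
rewrite fsbig_finite//= set_fsetK sumEFin.
rewrite [e](splitr e) EFinD; apply: leeD.
  rewrite lee_fin; apply: (@le_trans _ _ (\sum_(x <- F) e / 2 / (c + 1))).
    apply: ler_sum => x _; rewrite -[X in X `^ _]normr_id ltW//; apply: Hd.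
    rewrite normr_id (le_lt_trans (ler_normB _ _))//.
    apply: le_lt_trans (lerD (small k x.2) (small k x.1)) _.
    by rewrite [d]splitr ltrD.
  rewrite sum_const_fset -/c mulrCA ger_pMr//.
  by rewrite ler_pdivrMr; lra.
apply: (le_trans _ HF); apply: le_esum => x _; rewrite lee_fin.
by apply: ge0_ler_powR; rewrite ?nnegrE ?(ltW p0).
Unshelve. all: by end_near. Qed.

(** The part of u above height 1/(k+1) is finitely supported, and the remaining
    part has small values and is a contraction of u. *)
Lemma D0_of_levels p u : 1 <= p -> levels_finite u -> (energy p u < +oo)%E ->
  D0 p u.
Proof.
move=> p1 fu fin; have p0 : 0 < p by lra.
have ek (k : nat) : 0 <= k.+1%:R^-1 :> R by rewrite invr_ge0.
pose c k x := clamp k.+1%:R^-1 (u x).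
exists (fun k x => u x - c k x); split.
- move=> k; apply: (@sub_finite_set _ _ [set x | k.+1%:R^-1 < `|u x|]).
    move=> x /=; rewrite ltNge; apply: contra => H.
    by rewrite /c clamp_id// subrr.
  by apply: fu; rewrite invr_gt0.
- move=> x; apply/cvgrPdist_lt => e e0; near=> k.
  rewrite opprB addrCA subrr addr0 (le_lt_trans (clamp_norm _ (ek k)))//.
  by near: k; exact: near_infty_natSinv_lt (PosNum e0).
- have E k : dnorm p (fun x => u x - c k x - u x) = (energy p (c k) `^ p^-1)%E.
    rewrite dnormE; congr (_ `^ _)%E; apply: eq_esum => e _.
    rewrite -[X in (X `^ _)%:E]normrN; congr ((`| _ | `^ p)%:E); ring.
  have le_u k : (energy p (c k) <= energy p u)%E.
    by apply: (energy_lipschitz _ (ltW p0)) => a b; exact: clamp_lipschitz.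
  have finE k : energy p (c k) \is a fin_num.
    by rewrite ge0_fin_numE ?energy_ge0// (le_lt_trans (le_u k)).
  apply/fine_cvgP; split.
    by near=> k; rewrite E fin_num_poweR.
  apply/cvgrPdist_le => e e0; near=> k.
  rewrite sub0r normrN /= E fine_poweR ger0_norm ?powR_ge0//.
  have -> : e = (e `^ p) `^ p^-1 by rewrite -powRrM divff ?gt_eqF// powRr1// ltW.
  apply: ge0_ler_powR; rewrite ?nnegrE ?invr_ge0 ?(ltW p0) ?powR_ge0//.
    by rewrite fine_ge0// energy_ge0.
  rewrite -lee_fin fineK//; near: k.
  apply: (energy_small p0 fin) => //; last exact: powR_gt0.
    by move=> k x y; exact: clamp_lipschitz.
  by move=> k x; exact: clamp_norm.
Unshelve. all: by end_near. Qed.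

Lemma neighbors_ray_step x (i : 'I_N) (k : nat) :
  neighbors (x + k%:Z *: delta_mx 0 i) (x + k.+1%:Z *: delta_mx 0 i).
Proof.
apply/neighborsP; exists i, 1; split => //.
rewrite -addrA; congr (_ + _); rewrite /unit_step -scalerDl.
by congr (_ *: _); lia.
Qed.

(** Zero energy makes u constant on a line, which contradicts the finiteness of
    the level sets unless u vanishes there. *)
Lemma energy_gt0 p u : (0 < N)%N -> levels_finite u -> (exists x, u x != 0) ->
  (0 < energy p u)%E.
Proof.
move=> N0 fu [x ux]; rewrite lt_neqAle energy_ge0 andbT eq_sym; apply/eqP => E0.
have eqe (a b : lattice N) : neighbors a b -> u b = u a.
  move=> ab; apply/eqP; rewrite -subr_eq0 -normr_eq0; apply/eqP/(@powR_eq0_eq0 _ _ p).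
  apply/eqP; rewrite eq_le powR_ge0 andbT -lee_fin.
  have <- : energy p u = 0%:E by [].
  apply: (le_trans _ (@sum_fset_esum _ _ _ _ [fset (a, b)]%fset _)).
    by rewrite big_seq_fset1.
  by move=> e /=; rewrite inE => /eqP ->.
pose i : 'I_N := Ordinal N0.
have eqk (k : nat) : u (x + k%:Z *: delta_mx 0 i) = u x.
  elim: k => [|k IH]; first by rewrite scale0r addr0.
  by rewrite (eqe _ _ (neighbors_ray_step x i k)).
have nx0 : 0 < `|u x| / 2 by rewrite divr_gt0// normr_gt0.
pose f (k : nat) := x + k%:Z *: delta_mx 0 i.
have finj : injective f.
  move=> k l /addrI /rowP/(_ i); rewrite !mxE !eqxx !mulr1; exact: (can_inj absz_nat).
apply: infinite_nat; have := finite_preimage (in2W finj) (fu _ nx0).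
by congr finite_set; apply/seteqP; split => // k _ /=; rewrite eqk; lra.
Qed.
End CompletionMembership.

(** * Existence of a symmetric minimizer *)

Section Finiteness.
Context {R : realType}.

Lemma esum_lty {T : choiceType} (D : set T) (f : T -> R) (F : {fset T}) :
  (forall x, 0 <= f x) -> (forall x, D x -> x \notin F -> f x = 0) ->
  (\esum_(x in D) (f x)%:E < +oo)%E.
Proof.
move=> f0 fF; rewrite (esumID [set` F]); last by move=> x _; rewrite lee_fin.
rewrite [X in (_ + X)%E]esum1 ?adde0; last first.
  by move=> x [Dx /= xF]; rewrite fF//; exact/negP.
have fin : finite_set (D `&` [set` F]) by apply: finite_setIr.
rewrite esum_fset//; last by move=> i _; rewrite lee_fin.
by rewrite fsbig_finite//= sumEFin ltry.
Qed.

Lemma lee_poweR (r : R) (x y : \bar R) : 0 <= r -> (0 <= x)%E -> (x <= y)%E ->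
  (x `^ r <= y `^ r)%E.
Proof.
move=> r0 x0 xy; apply: (gt0_ler_poweR r0) => //.
  by rewrite in_itv/= x0 leey.
by rewrite in_itv/= (le_trans x0 xy) leey.
Qed.

Context {N : nat}.
Implicit Types (u v : lattice N -> R) (x y : lattice N) (p q r s t theta a b e : R).

Lemma mass_lty s u : 0 < s -> finitely_supported u -> (mass s u < +oo)%E.
Proof.
move=> s0 fu; apply: (@esum_lty _ _ _ (fset_set [set x | u x != 0])).
  by move=> x; exact: powR_ge0.
move=> x _; rewrite in_fset_set// notin_setE/= => /negP; rewrite negbK => /eqP ->.
by rewrite normr0 powR0// gt_eqF.
Qed.

Lemma neighbors_box x y : neighbors x y -> exists2 z, z \in @box N 1 & y = x + z.
Proof.
move=> /neighborsP[k [s [s1 ->]]]; exists (unit_step k s) => //.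
apply/boxP => i; rewrite !mxE eqxx/=.
by case: (i == k); rewrite ?mulr1 ?mulr0 ?normr0// s1.
Qed.

Lemma finite_neighbors x : finite_set (neighbors x).
Proof.
have fin : finite_set ((fun z => x + z) @` [set` @box N 1]) by exact: finite_image.
by apply: sub_finite_set fin => y /neighbors_box[z zb ->]; exists z.
Qed.

Lemma energy_lty p u : 0 < p -> finitely_supported u -> (energy p u < +oo)%E.
Proof.
move=> p0 fu; pose S := fset_set [set x | u x != 0].
pose F := ([fset (x, (x + z)%R) | x in S, z in @box N 1] `|`
           [fset ((x + z)%R, x) | x in S, z in @box N 1])%fset.
apply: (@esum_lty _ _ _ F); first by move=> x; exact: powR_ge0.
have zS x : x \notin S -> u x = 0.
  by rewrite in_fset_set// notin_setE/= => /negP; rewrite negbK => /eqP.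
move=> [x y]; rewrite /edges/= => xy; rewrite in_fsetU negb_or => /andP[h1 h2].
have ux : u x = 0.
  apply: zS; apply: contra h1 => xS; have [z zb ->] := neighbors_box xy.
  by apply/imfset2P; exists x => //; exists z.
have uy : u y = 0.
  apply: zS; apply: contra h2 => yS.
  have [z zb xE] := neighbors_box (neighbors_sym xy).
  by rewrite [in (x, y)]xE; apply/imfset2P; exists y => //; exists z.
by rewrite ux uy subrr normr0 powR0// gt_eqF.
Qed.

Lemma mass_gt0 s u : (exists x, u x != 0) -> (0 < mass s u)%E.
Proof.
move=> [x ux]; apply: (lt_le_trans _ (@sum_fset_esum _ _ _ _ [fset x]%fset _)) => //.
by rewrite big_seq_fset1 lte_fin powR_gt0// normr_gt0.
Qed.

Lemma mass_neq0 s u : s != 0 -> mass s u != 0%E -> exists x, u x != 0.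
Proof.
move=> s0 /eqP M0; apply: contrapT => /forallNP nz; apply: M0.
rewrite /mass esum1// => x _.
by have /negP := nz x; rewrite negbK => /eqP ->; rewrite normr0 powR0.
Qed.

(** By compactness. The same ultrafilter serves all points of the lattice at
    once. *)
Lemma ultra_limit {T : Type} (F : set_system T) (f : T -> R) : UltraFilter F ->
  (forall i, 0 <= f i <= 1) -> exists a, f i @[i --> F] --> a.
Proof.
move=> UF f01.
have [|a [_ ca]] := @segment_compact R 0 1 (f @ F) _.
  by apply: (@filterE _ F) => t; rewrite /= in_itv/=; exact: f01.
exists a => B nB; have [//|FC] := in_ultra_setVsetC (f @^-1` B) UF.
by have [b [/=]] := ca (~` B) B FC nB.
Qed.

End Finiteness.
Section Existence.
Context {R : realType} {N : nat}.
Implicit Types (u v : lattice N -> R) (x y : lattice N) (p q r s t theta a b e : R).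

Definition delta0 x : R := (x == 0)%:R.

Lemma delta0_finitely_supported : finitely_supported delta0.
Proof.
apply: sub_finite_set (finite_set1 (0 : lattice N)) => x /=.
by rewrite /delta0; case: (eqVneq x 0) => //= _; rewrite eqxx.
Qed.

Lemma finitely_supported_levels u : finitely_supported u -> levels_finite u.
Proof.
move=> fu t t0; apply: sub_finite_set fu => x /= tx.
by rewrite -normr_gt0 (lt_trans t0).
Qed.

Lemma mass_delta0 s : s != 0 -> mass s delta0 = 1%E.
Proof.
move=> s0; rewrite /mass (esumT_fset (F := [fset 0]%fset)).
- by rewrite big_seq_fset1 /delta0 eqxx normr1 powR1.
- by move=> x; rewrite inE /delta0 => /negbTE ->; rewrite normr0 powR0.
- by move=> x; exact: powR_ge0.
Qed.

Lemma delta0_admissible p q : 1 <= p -> 0 < q -> gn_admissible p q delta0.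
Proof.
move=> p1 q0; split.
  apply: D0_of_levels => //.
    exact/finitely_supported_levels/delta0_finitely_supported.
  by apply: energy_lty; [lra|exact: delta0_finitely_supported].
by apply/lnorm_eq1 => //; rewrite mass_delta0// gt_eqF.
Qed.

Lemma gn_functional_ge0 p r theta u : (0 <= gn_functional p r theta u)%E.
Proof. by rewrite gn_functionalE mule_ge0// poweR_ge0. Qed.

Lemma gn_inf_fin p q r theta : 1 <= p -> 0 < q -> 0 < r ->
  (@gn_inf R N p q r theta) \is a fin_num.
Proof.
move=> p1 q0 r0; rewrite ge0_fin_numE; last first.
  by apply: le_ereal_inf_tmp => _ [u _ <-]; exact: gn_functional_ge0.
apply: (@le_lt_trans _ _ (gn_functional p r theta delta0)).
  by apply: ereal_inf_lbound; exists delta0 => //; exact: delta0_admissible.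
have fd := delta0_finitely_supported.
rewrite gn_functionalE lte_mul_pinfty ?poweR_ge0//.
  by rewrite fin_num_poweR// ge0_fin_numE ?energy_ge0// energy_lty//; lra.
by rewrite poweR_lty// mass_lty.
Qed.

(** Take an almost minimizing function, cut it off at a small height and
    symmetrize; w is not renormalized, its mass is only close to 1. *)
Lemma near_minimizer p q r theta (d : R) : 1 < p -> 1 < r -> 0 < q ->
  0 <= theta <= 1 -> 0 < d <= 2^-1 ->
  exists w : lattice N -> R,
   [/\ forall x, 0 <= w x, finitely_supported w, symm w &
   [/\ (mass q w <= 1)%E, ((1 - d)%:E <= mass q w)%E &
     (gn_functional p r theta w <= @gn_inf R N p q r theta + d%:E)%E]].
Proof.
move=> p1 r1 q0 /andP[t0 t1] /andP[d0 d1].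
have p0 : 0 < p by lra.
have r0 : 0 < r by lra.
have fK := @gn_inf_fin p q r theta (ltW p1) q0 r0.
have [_ [v [Dv Lv] <-] Hv] := lb_ereal_inf_adherent d0 fK.
have Mv : mass q v = 1%E by apply/lnorm_eq1.
have [w1 [w10 fw1 Ew1 Mw1 Qw1]] := truncation (ltW p1) q0 Mv d0.
have [w [w0 fw sw Ew Mw]] := symmetrize (ltW p1) w10 fw1.
exists w; split => //; split.
- by rewrite Mw -Mv Mw1// ltW.
- by rewrite Mw.
- apply: le_trans (ltW Hv); rewrite !gn_functionalE Mw; apply: lee_pmul.
  + exact: poweR_ge0.
  + exact: poweR_ge0.
  + apply: lee_poweR; rewrite ?energy_ge0 ?(le_trans Ew)// divr_ge0// ltW//.
  + by apply: lee_poweR; rewrite ?mass_ge0 ?Mw1 ?(ltW r0)// divr_ge0 ?subr_ge0 ?(ltW r0).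
Qed.

Lemma cvg_powR_norm {T : Type} (F : set_system T) (FF : Filter F) (f : T -> R) c a :
  0 <= a -> f t @[t --> F] --> c ->
  (`|f t| `^ a) @[t --> F] --> `|c| `^ a.
Proof.
rewrite le_eqVlt => /predU1P[<- _|a0 fc].
  under eq_fun do rewrite powRr0.
  by rewrite powRr0; exact: cvg_cst.
exact: (continuous_cvg _ (continuous_norm_powR a0 (x := c)) fc).
Qed.

End Existence.

Section Limit.
Context {R : realType} {n : nat}.
Notation N := n.+1.
Implicit Types (u v : lattice N -> R) (x y : lattice N) (s t a b e : R).
Variables (p r theta q qs : R).
Hypotheses (hp : 1 < p) (hr : 1 < r) (ht0 : 0 < theta) (ht1 : theta <= 1).
Hypothesis (hqs : qs^-1 = theta * (p^-1 - N%:R^-1) + (1 - theta) / r).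
Hypotheses (qs1 : 1 < qs) (hq : qs < q).

Let a0 := theta / p.
Let b0 := (1 - theta) / r.

(** The supremum over finite subsums is taken in two steps. With G fixed, the
    bound on the first factor gives a finite energy; with the energy fixed, the
    bound on the second factor gives a finite mass. Both need the other factor
    to be positive, which also rules out the product of 0 and infinity. *)
Lemma functional_from_finite u (K : R) : (exists x, u x != 0) -> levels_finite u ->
  (forall (F : {fset lattice N * lattice N}) (G : {fset lattice N}),
    [set` F] `<=` edges ->
    (\sum_(e <- F) `|u e.2 - u e.1| `^ p) `^ a0 * (\sum_(x <- G) `|u x| `^ r) `^ b0 <= K) ->
  exists2 A, 0 < A & energy p u = A%:E /\
   ((theta < 1 -> exists2 B, 0 < B & mass r u = B%:E) /\
    (gn_functional p r theta u <= K%:E)%E).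
Proof.
move=> nu fu H.
have p0 : 0 < p := lt_trans ltr01 hp; have r0 : 0 < r := lt_trans ltr01 hr.
have a0p : 0 < a0 by rewrite divr_gt0.
have b0p : 0 <= b0 by rewrite divr_ge0 ?subr_ge0// ltW.
have eg := energy_gt0 p (ltn0Sn n) fu nu.
(* A bound on X^k c turned into a bound on X. *)
have root (X c k : R) : 0 < c -> 0 <= X -> 0 < k -> X `^ k * c <= K ->
    X <= (K / c) `^ k^-1.
  move=> c0 X0 k0 HX; have HX' : X `^ k <= K / c by rewrite ler_pdivlMr.
  rewrite -[leLHS](powRr1 X0) -[X in _ `^ X](divff (lt0r_neq0 k0)) powRrM.
  by apply: ge0_ler_powR; rewrite ?nnegrE ?invr_ge0 ?(ltW k0) ?powR_ge0// (le_trans _ HX')// powR_ge0.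
have rootK (c k : R) : 0 < c -> 0 < k -> 0 <= K -> ((K / c) `^ k^-1) `^ k * c = K.
  move=> c0 k0 K0; rewrite -powRrM mulVf ?gt_eqF// powRr1 ?divr_ge0// ?(ltW c0)//.
  by rewrite divfK// gt_eqF.
have K0 : 0 <= K.
  by apply: le_trans (H fset0 fset0 _); rewrite ?mulr_ge0 ?powR_ge0// => x.
have step1 (G : {fset lattice N}) : 0 < (\sum_(x <- G) `|u x| `^ r) `^ b0 ->
    exists2 A, 0 < A & energy p u = A%:E /\ A `^ a0 * (\sum_(x <- G) `|u x| `^ r) `^ b0 <= K.
  set c := _ `^ b0 => c0.
  have : (energy p u <= ((K / c) `^ a0^-1)%:E)%E.
    apply: esum_le_fset => F FE; rewrite lee_fin; apply: root => //; last exact: H.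
    by apply: sumr_ge0 => e _; exact: powR_ge0.
  move: eg; case: (energy p u) => [A| |]//; rewrite lte_fin lee_fin => A0 HA.
  exists A => //; split => //.
  rewrite -[leRHS](rootK c a0 c0 a0p K0) ler_pM2r//.
  by apply: ge0_ler_powR; rewrite ?nnegrE ?powR_ge0 ?(ltW A0)// ltW.
have [x0 ux0] := nu.
have [|A A0 [EA HA]] := step1 [fset x0]%fset.
  by rewrite big_seq_fset1 !powR_gt0// normr_gt0.
exists A => //; split=> //.
have [t1|t1] := ltP theta 1; last first.
  split => //.
  have tE : theta = 1 by apply/eqP; rewrite eq_le ht1 t1.
  have b00 : b0 = 0 by rewrite /b0 tE subrr mul0r.
  rewrite gn_functionalE EA -/a0 -/b0 b00 poweRe0 mule1 lee_fin.
  by move: HA; rewrite b00 powRr0 mulr1.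
have b0p' : 0 < b0 by rewrite divr_gt0// subr_gt0.
have c0 : 0 < A `^ a0 by exact: powR_gt0.
have Hm : (mass r u <= ((K / A `^ a0) `^ b0^-1)%:E)%E.
  apply: esum_le_fset => G _; rewrite lee_fin.
  have G0 : 0 <= \sum_(x <- G) `|u x| `^ r by apply: sumr_ge0 => x _; exact: powR_ge0.
  move: G0; rewrite le_eqVlt => /predU1P[<-|Gp]; first exact: powR_ge0.
  have [|A' _ [EA' HA']] := step1 G; first exact: powR_gt0.
  apply: root => //; first exact: ltW.
  by move: HA'; rewrite EA in EA'; case: EA' => <-; rewrite mulrC.
have mg := mass_gt0 r nu.
move: Hm mg; case EB : (mass r u) => [B| |]//; rewrite lee_fin lte_fin => HB B0.
split; first by move=> _; exists B.
rewrite gn_functionalE EA EB lee_fin -/a0 -/b0 mulrC.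
rewrite -[leRHS](rootK _ _ c0 b0p' K0) ler_pM2r//.
by apply: ge0_ler_powR; rewrite ?nnegrE ?powR_ge0 ?(ltW B0).
Qed.

(** Finite subsums of the near minimizers satisfy the bound up to an error that
    tends to 0. Mass is not lost at infinity because of the uniform tails. *)
Lemma exists_symmetric_limit : exists u : lattice N -> R,
  [/\ forall x, 0 <= u x, symm u, mass q u = 1%E &
   forall (F : {fset lattice N * lattice N}) (G : {fset lattice N}),
    [set` F] `<=` edges ->
    (\sum_(e <- F) `|u e.2 - u e.1| `^ p) `^ a0 * (\sum_(x <- G) `|u x| `^ r) `^ b0
      <= fine (@gn_inf R N p q r theta)].
Proof.
have p0 : 0 < p := lt_trans ltr01 hp; have r0 : 0 < r := lt_trans ltr01 hr.
have q0 : 0 < q := lt_trans (lt_trans ltr01 qs1) hq.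
have t01 : 0 <= theta <= 1 by rewrite ltW.
have a0p : 0 < a0 by rewrite divr_gt0.
have b0p : 0 <= b0 by rewrite divr_ge0 ?subr_ge0// ltW.
set K := @gn_inf R N p q r theta.
have fK : K \is a fin_num by apply: gn_inf_fin => //; exact: ltW.
pose d (k : nat) : R := k.+2%:R^-1.
have d0 k : 0 < d k by rewrite invr_gt0.
have d1 k : d k <= 2^-1 by rewrite lef_pV2 ?posrE// ler_nat.
have [w Hw] : {w : nat -> lattice N -> R & forall k,
   [/\ forall x, 0 <= w k x, finitely_supported (w k), symm (w k) &
   [/\ (mass q (w k) <= 1)%E, ((1 - d k)%:E <= mass q (w k))%E &
     (gn_functional p r theta (w k) <= K + (d k)%:E)%E]]}.
  apply: (@choice _ _ (fun k w => [/\ forall x, 0 <= w x, finitely_supported w, symm w &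
   [/\ (mass q w <= 1)%E, ((1 - d k)%:E <= mass q w)%E &
     (gn_functional p r theta w <= K + (d k)%:E)%E]])) => k.
  by apply: near_minimizer => //; rewrite d0 d1.
have w0 k x : 0 <= w k x by have [] := Hw k.
have w1 k x : w k x <= 1.
  have [_ _ _ [Q1 _ _]] := Hw k; rewrite leNgt; apply/negP => lt.
  have : (1%:E < mass q (w k))%E; last by rewrite ltNge Q1.
  apply: (lt_le_trans _ (@sum_fset_esum _ _ _ _ [fset x]%fset _)) => //.
  rewrite big_seq_fset1 lte_fin ger0_norm// -[ltLHS](_ : 1 `^ q = 1); last by rewrite powR1.
  by apply: gt0_ltr_powR => //; rewrite nnegrE.
have data k : exists A B, [/\ 0 < A, 0 < B, energy p (w k) = A%:E, mass r (w k) = B%:E &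
    A `^ a0 * B `^ b0 <= fine K + d k].
  have [_ fw _ [_ Q2 HG]] := Hw k.
  have nw : exists x, w k x != 0.
    apply: (@mass_neq0 _ _ q); rewrite gt_eqF// (lt_le_trans _ Q2)// lte_fin.
    by rewrite subr_gt0 (le_lt_trans (d1 k))// invf_lt1// ltr1n.
  have := energy_gt0 p (ltn0Sn n) (finitely_supported_levels fw) nw.
  have := energy_lty p0 fw; have := mass_lty r0 fw; have := mass_gt0 r nw.
  move: HG; rewrite gn_functionalE.
  case: (energy p (w k)) => [A| |]//; case: (mass r (w k)) => [B| |]//.
  rewrite -(fineK fK) -/a0 -/b0 !poweR_EFin -EFinM -EFinD lee_fin !lte_fin => HG B0 _ _ A0.
  by exists A, B.
(* The limit is taken along an ultrafilter U finer than the filter of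
   neighborhoods of infinity. *)
have [U [UU oU]] := ultraFilterLemma (eventually_filter).
have lim x : {a : R | w k x @[k --> U] --> a}.
  by apply: cid; apply: (@ultra_limit _ _ U (fun k => w k x) UU) => k; rewrite w0 w1.
pose u x := sval (lim x).
have cu x : w k x @[k --> U] --> u x by exact: (svalP (lim x)).
have PU : ProperFilter U by exact: ultra_proper.
have FU : Filter U by exact: _.
have cd : d k @[k --> U] --> 0.
  have cd' : d k @[k --> \oo] --> 0.
    apply/cvgrPdist_lt => e e0; near=> k.
    rewrite sub0r normrN ger0_norm ?(ltW (d0 k))//.
    apply: (@lt_trans _ _ k.+1%:R^-1); first by rewrite ltf_pV2 ?posrE// ltr_nat.
    by near: k; exact: near_infty_natSinv_lt (PosNum e0).
  by move=> B nB; apply: oU; exact: cd'.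
have cmass s (G : {fset lattice N}) : 0 <= s ->
    (\sum_(x <- G) `|w k x| `^ s) @[k --> U] --> \sum_(x <- G) `|u x| `^ s.
  by move=> s0; apply: cvg_sum_seq => x; exact: cvg_powR_norm.
have cenergy (F : {fset lattice N * lattice N}) :
    (\sum_(e <- F) `|w k e.2 - w k e.1| `^ p) @[k --> U] -->
    \sum_(e <- F) `|u e.2 - u e.1| `^ p.
  apply: cvg_sum_seq => x; apply: cvg_powR_norm; first exact: ltW.
  by apply: cvgB.
exists u; split.
- by move=> x; apply: (cvgr_to_ge (cu x)); apply: nearW => k.
- move=> dd c x vd nx; rewrite -subr_ge0.
  apply: (cvgr_to_ge (cvgB (cu x) (cu (refl dd c x)))); apply: nearW => k /=.
  by rewrite subr_ge0; have [_ _ sw _] := Hw k; exact: sw.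
- apply/eqP; rewrite eq_le; apply/andP; split.
    apply: esum_le_fset => F _; rewrite lee_fin.
    apply: (cvgr_to_le (cmass q F (ltW q0))); apply: nearW => k.
    have [_ _ _ [Q1 _ _]] := Hw k; rewrite -lee_fin (le_trans _ Q1)//.
    exact: sum_fset_esum.
  apply/lee_addgt0Pr => e e0.
  (* The values of the functional on the sequence are at most the infimum plus
     1, which gives uniform tails. *)
  have G0 : 0 <= fine K + 1.
    by rewrite addr_ge0// fine_ge0// le_ereal_inf_tmp// => _ [v _ <-]; exact: gn_functional_ge0.
  have [F HF] := @uniform_tail R n p r theta q qs hp hr t01 hqs qs1 hq (fine K + 1) e G0 e0.
  apply: (@le_trans _ _ (\sum_(x <- F) `|u x| `^ q + e)%:E); last first.
    by rewrite EFinD leeD2r// sum_fset_esum.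
  rewrite lee_fin.
  have := cvgD (cmass q F (ltW q0)) cd; rewrite addr0 => /(_ FU) cF.
  rewrite -lerBlDr; apply: (cvgr_to_ge cF); apply: nearW => k /=.
  have [_ fw sw [_ Q2 _]] := Hw k.
  have [A [B [A0 B0 EA EB HAB]]] := data k.
  have := HF (w k) A B sw (w0 k) fw A0 B0; rewrite EA EB => /(_ (lexx _) (lexx _)).
  rewrite -/a0 -/b0 => /(_ _)/(le_trans Q2); rewrite lee_fin => H.
  rewrite lerBlDr addrAC -lerBlDr; apply: H.
  by rewrite (le_trans HAB)// lerD2l (le_trans (d1 k))// invf_le1// ler1n.
- move=> F G FE.
  have Gs k : 0 <= \sum_(x <- G) `|w k x| `^ r.
    by apply: sumr_ge0 => x _; exact: powR_ge0.
  have Fs k : 0 <= \sum_(e <- F) `|w k e.2 - w k e.1| `^ p.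
    by apply: sumr_ge0 => x _; exact: powR_ge0.
  have Gu : 0 <= \sum_(x <- G) `|u x| `^ r.
    by apply: sumr_ge0 => x _; exact: powR_ge0.
  have Fu : 0 <= \sum_(e <- F) `|u e.2 - u e.1| `^ p.
    by apply: sumr_ge0 => x _; exact: powR_ge0.
  have := cvgB (cvgM (cvg_powR_norm FU (ltW a0p) (cenergy F))
    (cvg_powR_norm FU b0p (cmass r G (ltW r0)))) cd.
  rewrite subr0 (ger0_norm Fu) (ger0_norm Gu) => /(_ FU FU) cFG.
  apply: (cvgr_to_le cFG); apply: nearW => k /=.
  have [A [B [A0 B0 EA EB HAB]]] := data k.
  change (`|\sum_(e <- F) `|w k e.2 - w k e.1| `^ p| `^ a0 *
          `|\sum_(x <- G) `|w k x| `^ r| `^ b0 - d k <= fine K).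
  rewrite lerBlDr; apply: le_trans HAB; rewrite (ger0_norm (Fs k)) (ger0_norm (Gs k)).
  apply: ler_pM; rewrite ?powR_ge0// ge0_ler_powR ?nnegrE ?(ltW a0p) ?(ltW A0) ?(ltW B0)//.
    by rewrite -lee_fin -EA; exact: sum_fset_esum.
  by rewrite -lee_fin -EB; exact: sum_fset_esum.
Unshelve. all: by end_near. Qed.

End Limit.

(** * Variations of a minimizer *)

Section Calculus.
Context {R : realType}.
Implicit Types (t a b c K : R).

Lemma is_derive_sum_seq {I : Type} (s : seq I) (f : I -> R -> R) (df : I -> R) t :
  (forall i, is_derive t 1 (f i) (df i)) ->
  is_derive t 1 (fun t => \sum_(i <- s) f i t) (\sum_(i <- s) df i).
Proof.
move=> H; elim: s => [|i s IH].
  under eq_fun do rewrite big_nil.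
  by rewrite big_nil; exact: is_derive_cst.
under eq_fun do rewrite big_cons.
by rewrite big_cons; exact: is_deriveD.
Qed.

(** The logarithm of A^a B^b / Q^c is minimal at 0, so its derivative vanishes
    there. *)
Lemma log_min (A B Q dA dB dQ : R -> R) K a b c :
  (forall t, is_derive t 1 A (dA t)) -> (forall t, is_derive t 1 B (dB t)) ->
  (forall t, is_derive t 1 Q (dQ t)) ->
  0 < A 0 -> 0 < B 0 -> 0 < Q 0 -> 0 < K ->
  (forall t, 0 < A t -> 0 < B t -> 0 < Q t -> K * Q t `^ c <= A t `^ a * B t `^ b) ->
  K * Q 0 `^ c = A 0 `^ a * B 0 `^ b ->
  a * (dA 0 / A 0) + b * (dB 0 / B 0) = c * (dQ 0 / Q 0).
Proof.
move=> hA hB hQ A0 B0 Q0 K0 Hmin H0.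
have cont (f df : R -> R) : (forall t, is_derive t 1 f (df t)) -> 0 < f 0 ->
    \forall t \near (0 : R), 0 < f t.
  move=> hf f0; apply: (@cvgr_gt R R (nbhs (0 : R)) _ f (f 0)) => //.
  apply/differentiable_continuous/derivable1_diffP.
  by have [] := hf 0.
have : \forall t \near (0 : R), [/\ 0 < A t, 0 < B t & 0 < Q t].
  by near=> t; split; near: t; [exact: (cont A dA)|exact: (cont B dB)|exact: (cont Q dQ)].
move=> /nbhs_ballP[e /= e0 He].
pose phi t := a * ln (A t) + b * ln (B t) - c * ln (Q t).
pose dphi t := a * ((A t)^-1 * dA t) + b * ((B t)^-1 * dB t) - c * ((Q t)^-1 * dQ t).
have dP t : 0 < A t -> 0 < B t -> 0 < Q t -> is_derive t 1 phi (dphi t).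
  move=> At Bt Qt.
  have ln' (f df : R -> R) k : is_derive t 1 f (df t) -> 0 < f t ->
      is_derive t 1 (fun t => k * ln (f t)) (k * ((f t)^-1 * df t)).
    move=> hf ft; have H1 := is_derive1_comp (is_derive1_ln ft) hf.
    exact: (is_deriveZ k H1).
  by apply: is_deriveB; [apply: is_deriveD|]; exact: ln'.
have inb t : t \in `]- e, e[ -> [/\ 0 < A t, 0 < B t & 0 < Q t].
  rewrite in_itv/= => /andP[h1 h2]; apply: He; rewrite /ball/= sub0r normrN.
  by rewrite ltr_norml h1 h2.
have ep : - e <= e by lra.
have D0 : is_derive (0 : R) 1 phi 0.
  apply: (derive1_at_min ep).
  - by move=> t /inb[At Bt Qt]; have [] := dP t At Bt Qt.
  - by rewrite in_itv/=; lra.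
  - move=> t /inb[At Bt Qt].
    have -> : phi 0 = ln K.
      have : ln (K * Q 0 `^ c) = ln (A 0 `^ a * B 0 `^ b) by rewrite H0.
      rewrite !lnM ?posrE ?powR_gt0// !ln_powR /phi; lra.
    have : ln (K * Q t `^ c) <= ln (A t `^ a * B t `^ b).
      by rewrite ler_ln ?posrE ?mulr_gt0 ?powR_gt0//; exact: Hmin.
    by rewrite !lnM ?posrE ?powR_gt0// !ln_powR /phi; lra.
have := dP 0 A0 B0 Q0 => -[_ E1]; have [_ E2] := D0.
move: E1; rewrite E2 /dphi => E.
rewrite ![dA 0 / _]mulrC ![dB 0 / _]mulrC ![dQ 0 / _]mulrC; lra.
Unshelve. all: by end_near. Qed.

Lemma is_derive_shift (p c t : R) : 1 < p ->
  is_derive t 1 (fun t => `|c + t| `^ p) (p * (`|c + t| `^ (p - 2) * (c + t))).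
Proof.
move=> p1.
have H : is_derive t 1 (fun t : R => c + t) 1.
  by rewrite -[X in is_derive _ _ _ X]add0r; apply: is_deriveD.
rewrite -[X in is_derive _ _ _ X]mulr1.
exact: (is_derive1_comp (is_derive_norm_powR (c + t) p1) H).
Qed.

End Calculus.

Section Variation.
Context {R : realType} {N : nat}.
Implicit Types (u v : lattice N -> R) (x y : lattice N) (p q r s t theta a b e : R).

Definition bump u x t : lattice N -> R := fun y => u y + (if y == x then t else 0).

Lemma mass_split s u x : mass s u =
  ((`|u x| `^ s)%:E + \esum_(y in ~` [set x]) (`|u y| `^ s)%:E)%E.
Proof.
rewrite /mass (esumID [set x]); last by move=> y _; rewrite lee_fin powR_ge0.
by rewrite !setTI esum_set1 ?lee_fin ?powR_ge0.
Qed.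

Lemma mass_bump s u x (m : R) : mass s u = m%:E ->
  exists2 m0 : R, 0 <= m0 & forall t, mass s (bump u x t) = (m0 + `|u x + t| `^ s)%:E.
Proof.
rewrite (mass_split _ _ x) => E.
have r0 : (0 <= \esum_(y in ~` [set x]) (`|u y| `^ s)%:E)%E.
  by apply: esum_ge0 => y _; rewrite lee_fin powR_ge0.
have H t : mass s (bump u x t) =
    ((`|u x + t| `^ s)%:E + \esum_(y in ~` [set x]) (`|u y| `^ s)%:E)%E.
  rewrite (mass_split _ _ x) /bump eqxx; congr (_ + _)%E; apply: eq_esum => y /= yx.
  by case: eqP => //; rewrite addr0.
move: E r0 H; case: (\esum_(y in ~` [set x]) _)%E => [m0| |]// _ m00 H.
by exists m0 => // t; rewrite H -EFinD addrC.
Qed.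

(** Edges at x are counted twice, once for each orientation. *)
Lemma energy_split p u x : energy p u =
  ((2 * \sum_(y <- fset_set (neighbors x)) `|u y - u x| `^ p)%:E +
   \esum_(e in edges `&` [set e | e.1 != x /\ e.2 != x]) (`|u e.2 - u e.1| `^ p)%:E)%E.
Proof.
have fn := finite_neighbors x.
have ge (e : lattice N * lattice N) : (0 <= (`|u e.2 - u e.1| `^ p)%:E)%E.
  by rewrite lee_fin powR_ge0.
rewrite /energy (esumID [set e | e.1 = x]); last by move=> e _; exact: ge.
rewrite [X in (_ + X)%E](esumID [set e | e.2 = x]); last by move=> e _; exact: ge.
have -> : edges `&` [set e | e.1 = x] = (fun y => (x, y)) @` neighbors x.
  apply/seteqP; split => [[a b] [/= ab ax]|_ [y xy <-]]; last by split.
  by exists b; rewrite -ax.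
have -> : edges `&` ~` [set e | e.1 = x] `&` [set e | e.2 = x] =
    (fun y => (y, x)) @` neighbors x.
  apply/seteqP; split => [[a b] [[/= ab ax] bx]|_ [y xy <-]].
    by exists a; rewrite -?bx//; exact: neighbors_sym.
  split=> //; split; first exact: neighbors_sym.
  by move=> /= yx; apply: (@neighbors_irr _ x); rewrite -{2}yx.
rewrite !esum_image; try by move=> y y' _ _ [].
rewrite (esum_fset fn); last by move=> y _; rewrite lee_fin powR_ge0.
rewrite (esum_fset fn); last by move=> y _; rewrite lee_fin powR_ge0.
rewrite !fsbig_finite//= !sumEFin addeA -EFinD mulrDl !mul1r.
congr (_ + _)%E.
  congr (_ + _)%:E; apply: eq_bigr => y _; by rewrite distrC.
congr esum; apply/seteqP; split => [e [[ee e1] e2]|e [ee [/eqP e1 /eqP e2]]].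
  by split => //; split; apply/eqP.
by split.
Qed.

Lemma energy_bump p u x (A : R) : energy p u = A%:E ->
  exists2 A0 : R, 0 <= A0 & forall t, energy p (bump u x t) =
    (A0 + 2 * \sum_(y <- fset_set (neighbors x)) `|(u x - u y) + t| `^ p)%:E.
Proof.
rewrite (energy_split _ _ x) => E.
have r0 : (0 <= \esum_(e in edges `&` [set e | e.1 != x /\ e.2 != x])
    (`|u e.2 - u e.1| `^ p)%:E)%E.
  by apply: esum_ge0 => y _; rewrite lee_fin powR_ge0.
have H t : energy p (bump u x t) =
  ((2 * \sum_(y <- fset_set (neighbors x)) `|(u x - u y) + t| `^ p)%:E +
   \esum_(e in edges `&` [set e | e.1 != x /\ e.2 != x]) (`|u e.2 - u e.1| `^ p)%:E)%E.
  rewrite (energy_split _ _ x); congr (_ + _)%E.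
    congr (_ * _)%:E; rewrite big_seq [RHS]big_seq; apply: eq_bigr => y.
    rewrite in_fset_set ?inE; last exact: finite_neighbors.
    move=> xy; rewrite /bump eqxx; case: eqP => [E'|_].
      by case: (@neighbors_irr _ x); rewrite -{2}E'.
    by rewrite addr0 distrC; congr (`| _ | `^ _); ring.
  apply: eq_esum => e [_ [/negbTE e1 /negbTE e2]].
  by rewrite /bump e1 e2 !addr0.
move: E r0 H; case: (\esum_(e in _ `&` _) _)%E => [m0| |]// _ m00 H.
by exists m0 => // t; rewrite H -EFinD addrC.
Qed.

Lemma esum_scale_le {T : choiceType} (D : set T) (f g : T -> R) (c M : R) :
  0 <= c -> (forall i, g i = c * f i) ->
  (\esum_(i in D) (f i)%:E <= M%:E)%E -> (\esum_(i in D) (g i)%:E <= (c * M)%:E)%E.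
Proof.
move=> c0 gf H; apply: esum_le_fset => F FD; rewrite lee_fin.
under eq_bigr => i _ do rewrite gf.
rewrite -mulr_sumr ler_wpM2l// -lee_fin; apply: le_trans H.
exact: sum_fset_esum.
Qed.

Lemma mass_scale_le s u (c M : R) : 0 <= c -> (mass s u <= M%:E)%E ->
  (mass s (fun x => (c * u x)%R) <= (c `^ s * M)%:E)%E.
Proof.
move=> c0; apply: esum_scale_le; first exact: powR_ge0.
by move=> x; rewrite normrM powRM// (ger0_norm c0).
Qed.

Lemma energy_scale_le p u (c M : R) : 0 <= c -> (energy p u <= M%:E)%E ->
  (energy p (fun x => (c * u x)%R) <= (c `^ p * M)%:E)%E.
Proof.
move=> c0; apply: esum_scale_le; first exact: powR_ge0.
by move=> x; rewrite -mulrBr normrM powRM// (ger0_norm c0).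
Qed.

(** The functional is homogeneous of degree 1, so the bound for functions of
    mass 1 applies to v divided by its norm. The assumption on B is conditional
    because for theta = 1 the mass of exponent r may be infinite. *)
Lemma gn_competitor p q r theta v (A B Q : R) : 1 < p -> 1 < r -> 0 < q ->
  0 <= theta <= 1 ->
  energy p v = A%:E -> mass q v = Q%:E -> 0 <= A -> 0 < B -> 0 < Q ->
  (theta < 1 -> mass r v = B%:E) ->
  fine (@gn_inf R N p q r theta) * Q `^ q^-1 <=
  A `^ (theta / p) * B `^ ((1 - theta) / r).
Proof.
move=> p1 r1 q0 /andP[t0 t1] EA EQ A0 B0 Q0 EB.
have p0 : 0 < p by lra.
have r0 : 0 < r by lra.
set K := gn_inf _ _ _ _.
have fK : K \is a fin_num by apply: gn_inf_fin => //; exact: ltW.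
have [c [cE c0 cq]] : exists c, [/\ c = Q `^ (- q^-1), 0 < c & c `^ q = Q^-1].
  exists (Q `^ (- q^-1)); split; [by []|exact: powR_gt0|].
  by rewrite -powRrM mulNr mulVf ?gt_eqF// powR_inv1// ltW.
pose w x := c * v x.
(* Scaling back from w to v gives the lower bound. *)
have Mw : mass q w = 1%E.
  apply/eqP; rewrite eq_le; apply/andP; split.
    have := @mass_scale_le q v c Q (ltW c0); rewrite EQ => /(_ (lexx _)).
    by rewrite cq mulVf// gt_eqF.
  have ci : 0 <= c^-1 by rewrite invr_ge0 ltW.
  case EM : (mass q w) => [m| |]; [|by rewrite leey|by move: (mass_ge0 q w); rewrite EM].
  have := @mass_scale_le q w c^-1 m ci; rewrite EM => /(_ (lexx _)).
  have -> : (fun x => c^-1 * w x) = v by apply/funext => x; rewrite /w mulKf ?gt_eqF.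
  rewrite EQ !lee_fin -powR_inv1 ?(ltW c0)// powRAC cq powR_inv1 ?invr_ge0 ?(ltW Q0)// invrK.
  by rewrite -[leLHS]mulr1 ler_pM2l.
have Ew : (energy p w <= (c `^ p * A)%:E)%E by apply: energy_scale_le; rewrite ?EA// ltW.
have aw : gn_admissible p q w.
  split; last exact/lnorm_eq1.
  apply: D0_of_levels; first exact: ltW.
    by move=> t; apply: (mass_levels q0); rewrite Mw ltry.
  by rewrite (le_lt_trans Ew)// ltry.
have Kw : (K <= gn_functional p r theta w)%E by apply: ereal_inf_lbound; exists w.
have : (K <= ((c `^ p * A) `^ (theta / p) * (c `^ r * B) `^ ((1 - theta) / r))%:E)%E.
  apply: (le_trans Kw); rewrite gn_functionalE EFinM -!poweR_EFin.
  apply: lee_pmul; rewrite ?poweR_ge0//.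
    by apply: lee_poweR; rewrite ?energy_ge0// divr_ge0// ltW.
  have [tl|tg] := ltP theta 1.
    apply: lee_poweR; rewrite ?mass_ge0//; first by rewrite divr_ge0 ?subr_ge0// ltW.
    by apply: mass_scale_le; rewrite ?EB// ltW.
  have -> : theta = 1 by apply/eqP; rewrite eq_le t1 tg.
  by rewrite subrr mul0r !poweRe0.
rewrite -(fineK fK) lee_fin => H.
rewrite -ler_pdivlMr ?powR_gt0// -powRN -cE; apply: (le_trans H).
rewrite !powRM ?powR_ge0// ?(ltW B0)// -!powRrM.
rewrite (_ : p * (theta / p) = theta); last by field; rewrite gt_eqF.
rewrite (_ : r * ((1 - theta) / r) = 1 - theta); last by field; rewrite gt_eqF.
rewrite mulrACA -powRD; last by rewrite (gt_eqF c0) implybT.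
by rewrite subrKC powRr1 ?(ltW c0)// mulrC.
Qed.

End Variation.

(** * The Euler-Lagrange equation and positivity *)

Section EulerLagrange.
Context {R : realType} {N : nat}.
Implicit Types (u v : lattice N -> R) (x y z : lattice N) (p q r s t theta a b e : R).

Lemma plaplacianE p u x : plaplacian p u x =
  \sum_(y <- fset_set (neighbors x)) `|u y - u x| `^ (p - 2) * (u y - u x).
Proof. by rewrite /plaplacian fsbig_finite//; exact: finite_neighbors. Qed.

(** Apply [log_min] to t |-> u + t delta_x. The factor 2 in front of theta
    comes from the two orientations of an edge; for theta = 1 the mass of
    exponent r may be infinite and is replaced by the constant B. *)
Lemma euler_lagrange p q r theta u (A B : R) : 1 < p -> 1 < r -> 1 < q ->
  0 <= theta <= 1 -> (forall x, 0 <= u x) ->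
  energy p u = A%:E -> mass q u = 1%E -> 0 < A -> 0 < B ->
  (theta < 1 -> mass r u = B%:E) ->
  gn_functional p r theta u = @gn_inf R N p q r theta ->
  forall x, 2 * theta / A * plaplacian p u x - (1 - theta) / B * u x `^ (r - 1)
     + u x `^ (q - 1) = 0.
Proof.
move=> p1 r1 q1 t01 u0 EA EQ A0 B0 EB EK x; have /andP[t0 t1] := t01.
have p0 : 0 < p by lra.
have r0 : 0 < r by lra.
have q0 : 0 < q by lra.
have [A1 A10 HA] := energy_bump x EA.
have [Q1 Q10 HQ] := mass_bump x EQ.
pose Af t := A1 + 2 * \sum_(y <- fset_set (neighbors x)) `|(u x - u y) + t| `^ p.
pose dA t := 2 * \sum_(y <- fset_set (neighbors x))
   p * (`|(u x - u y) + t| `^ (p - 2) * ((u x - u y) + t)).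
pose Qf t := Q1 + `|u x + t| `^ q.
pose dQ t := q * (`|u x + t| `^ (q - 2) * (u x + t)).
have b0 : bump u x 0 = u by apply/funext => y; rewrite /bump if_same addr0.
have Af0 : Af 0 = A by have := HA 0; rewrite b0 EA => -[].
have Qf0 : Qf 0 = 1 by have := HQ 0; rewrite b0 EQ => -[].
have hA t : is_derive t 1 Af (dA t).
  rewrite -[X in is_derive _ _ _ X]add0r; apply: is_deriveD.
  apply: is_deriveZ; apply: is_derive_sum_seq => y; exact: is_derive_shift.
have hQ t : is_derive t 1 Qf (dQ t).
  rewrite -[X in is_derive _ _ _ X]add0r; apply: is_deriveD.
  exact: is_derive_shift.
have pow1 s : 1 < s -> `|u x| `^ (s - 2) * u x = u x `^ (s - 1).
  move=> s1; rewrite ger0_norm//; have := u0 x; rewrite le_eqVlt => /predU1P[<-|ux].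
    by rewrite mulr0 powR0//; lra.
  rewrite -[X in _ * X](powRr1 (ltW ux)) -powRD; last by rewrite (gt_eqF ux) implybT.
  by congr powR; lra.
have [Bf [dB [hB Bf0 HB dB0]]] : exists Bf dB : R -> R,
    [/\ forall t, is_derive t 1 Bf (dB t), Bf 0 = B,
      theta < 1 -> forall t, mass r (bump u x t) = (Bf t)%:E &
      (1 - theta) / r * (dB 0 / B) = (1 - theta) / B * u x `^ (r - 1)].
  have [tl|tg] := ltP theta 1; last first.
    exists (fun=> B), (fun=> 0); split => //; first by move=> t; exact: is_derive_cst.
    have -> : theta = 1 by apply/eqP; rewrite eq_le t1 tg.
    by rewrite subrr !mul0r.
  have [B1 B10 HB] := mass_bump x (EB tl).
  exists (fun t => B1 + `|u x + t| `^ r), (fun t => r * (`|u x + t| `^ (r - 2) * (u x + t))).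
  split.
  - move=> t; rewrite -[X in is_derive _ _ _ X]add0r; apply: is_deriveD.
    exact: is_derive_shift.
  - by have := HB 0; rewrite b0 (EB tl) => -[].
  - by move=> _.
  - by rewrite addr0 pow1//; field; rewrite !gt_eqF.
set K := @gn_inf R N p q r theta in EK.
have fK : K \is a fin_num by apply: gn_inf_fin => //; exact: ltW.
have GK : A `^ (theta / p) * B `^ ((1 - theta) / r) = fine K.
  rewrite -EK gn_functionalE EA.
  have [tl|tg] := ltP theta 1; first by rewrite (EB tl).
  have -> : theta = 1 by apply/eqP; rewrite eq_le t1 tg.
  by rewrite subrr mul0r powRr0 poweRe0 mule1 mulr1.
have K0 : 0 < fine K by rewrite -GK mulr_gt0 ?powR_gt0.
have := @log_min R Af Bf Qf dA dB dQ (fine K) (theta / p) ((1 - theta) / r) q^-1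
  hA hB hQ.
have Hmin t : 0 < Af t -> 0 < Bf t -> 0 < Qf t ->
    fine K * Qf t `^ q^-1 <= Af t `^ (theta / p) * Bf t `^ ((1 - theta) / r).
  move=> At Bt Qt; apply: (@gn_competitor R N p q r theta (bump u x t)) => //.
    exact: ltW.
  by move=> tl; exact: HB.
rewrite Af0 Bf0 Qf0 powR1 mulr1 => /(_ A0 B0 ltr01 K0 Hmin (esym GK)).
have -> : q^-1 * (dQ 0 / 1) = u x `^ (q - 1).
  by rewrite /dQ addr0 pow1// divr1 mulrA mulVf ?gt_eqF// mul1r.
rewrite dB0 => <-.
have -> : dA 0 = - (2 * p) * plaplacian p u x.
  rewrite plaplacianE /dA mulNr -mulrA -mulrN; congr (_ * _).
  rewrite mulr_sumr -sumrN; apply: eq_bigr => y _.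
  by rewrite addr0 distrC -mulrN; congr (_ * _); rewrite -mulrN opprB.
by field; rewrite !gt_eqF.
Qed.

(** The lattice is connected: coordinates are changed one at a time, by unit
    steps. *)
Lemma neighbors_closed (P : lattice N -> Prop) x :
  (forall y z, P y -> neighbors y z -> P z) -> P x -> forall y, P y.
Proof.
move=> cl Px y.
have line (k : nat) (s : int) (i : 'I_N) z : `|s| = 1 -> P z ->
    P (z + (k%:Z * s) *: delta_mx 0 i).
  move=> s1 Pz; elim: k => [|k IH]; first by rewrite mul0r scale0r addr0.
  apply: (cl _ _ IH); apply/neighborsP; exists i, s; split => //.
  by rewrite -addrA /unit_step -scalerDl; congr (_ + _ *: _); lia.
have lineZ (t : int) (i : 'I_N) z : P z -> P (z + t *: delta_mx 0 i).
  move=> Pz; have [t0|t0] := leP 0 t.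
    by have := line `|t|%N 1 i z erefl Pz; rewrite mulr1 gez0_abs.
  have := line `|t|%N (-1) i z erefl Pz; rewrite mulrN1 ltz0_abs// opprK//.
have Hs (s : seq 'I_N) : P (\row_k (if k \in s then y 0 k else x 0 k)).
  elim: s => [|i s IH].
    have -> // : \row_k (if k \in [::] then y 0 k else x 0 k) = x.
    by apply/rowP => k; rewrite mxE.
  set h := \row_k _ in IH.
  have -> : \row_k (if k \in i :: s then y 0 k else x 0 k) =
     h + (y 0 i - h 0 i) *: delta_mx 0 i; last exact: lineZ.
  apply/rowP => k; rewrite !mxE inE eqxx/=.
  case: (eqVneq k i) => [->|_] /=; last by rewrite mulr0 addr0.
  by rewrite mulr1; ring.
have := Hs (enum 'I_N); congr P.
by apply/rowP => k; rewrite mxE mem_enum.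
Qed.

(** At a zero of u all terms of the equation but the p-Laplacian vanish, and
    the p-Laplacian is a sum of nonnegative terms; so u vanishes at the
    neighbors, and then everywhere. *)
Lemma positive_of_equation p q r u (l1 l2 : R) : 1 < p -> 1 < r -> 1 < q ->
  0 < l1 -> (forall x, 0 <= u x) -> (exists x, u x != 0) ->
  (forall x, l1 * plaplacian p u x - l2 * u x `^ (r - 1) + u x `^ (q - 1) = 0) ->
  forall x, 0 < u x.
Proof.
move=> p1 r1 q1 l10 u0 [x0 ux0] H x; rewrite lt_neqAle u0 andbT eq_sym.
apply/eqP => ux; move/eqP: ux0; apply.
apply: (@neighbors_closed (fun x => u x = 0) x) => // y z uy yz.
have := H y; rewrite uy !powR0; try by apply/eqP; lra.
rewrite mulr0 subr0 addr0 => /eqP; rewrite mulf_eq0 gt_eqF//= plaplacianE.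
rewrite psumr_eq0; last by move=> w _; rewrite mulr_ge0 ?powR_ge0// uy subr0.
move=> /allP/(_ z); rewrite in_fset_set ?mem_set//; last exact: finite_neighbors.
move=> /(_ isT); rewrite /= uy subr0 mulf_eq0 => /orP[/eqP/powR_eq0_eq0/eqP|/eqP//].
by rewrite normr_eq0 => /eqP.
Qed.

(** If the reflection of a preferred point x is 0, then the form takes the
    value 2c at x, which is on the preferred side only if c = 0. *)
Lemma symm_delta0 : symm (@delta0 R N).
Proof.
move=> d c x vd nx; rewrite /delta0.
case: (eqVneq (refl d c x) 0) => [E|_]; last by rewrite ler0n.
have xE : x = refl d c 0 by rewrite -E reflK.
have S0 : axis_form d 0 = 0 by rewrite -(scale0r 0) axis_formZ mul0r.
move: nx; rewrite /near {1 2}xE axis_form_refl// S0 subr0.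
have [cE|c0] := eqVneq c 0; last by case: ifP; lia.
by move=> _; rewrite xE cE refl_fix// eqxx.
Qed.

Lemma C0plus_levels u : (forall x, 0 <= u x) -> levels_finite u -> C0plus u.
Proof.
move=> u0 fu; split => // t t0; apply: sub_finite_set (fu t t0) => x /=.
by rewrite ger0_norm.
Qed.

End EulerLagrange.

(** * The ground state *)


(** A function of q-mass 1 has |v| <= 1, so that |v|^q <= |v|^r. *)
Lemma delta0_minimizer (R : realType) (N : nat) (p q r : R) : 1 < p -> 1 < r ->
  r <= q -> gn_minimizer p q r 0 (@delta0 R N).
Proof.
move=> p1 r1 rq; have r0 : 0 < r by lra.
have q0 : 0 < q by lra.
have aD : gn_admissible p q (@delta0 R N) by apply: delta0_admissible => //; exact: ltW.
split => //; apply/eqP; rewrite eq_le; apply/andP; split; last first.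
  by apply: ereal_inf_lbound; exists (@delta0 R N).
apply: le_ereal_inf_tmp => _ [v [_ /(lnorm_eq1 _ q0) Mv] <-].
rewrite !gn_functionalE !mul0r !poweRe0 !mul1e subr0 mass_delta0 ?gt_eqF//.
apply: lee_poweR; rewrite ?divr_ge0 ?(ltW r0)//.
rewrite -Mv; apply: le_esum => x _; rewrite lee_fin.
have v1 : `|v x| <= 1.
  rewrite leNgt; apply/negP => lt.
  have : (1%:E < mass q v)%E; last by rewrite Mv ltxx.
  apply: (lt_le_trans _ (@sum_fset_esum _ _ _ _ [fset x]%fset _)) => //.
  rewrite big_seq_fset1 lte_fin -[ltLHS](_ : 1 `^ q = 1); last by rewrite powR1.
  by apply: gt0_ltr_powR => //; rewrite nnegrE.
have := normr_ge0 (v x); rewrite le_eqVlt => /predU1P[<-|vx].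
  by rewrite !powR0 ?gt_eqF.
by apply: ger_powR => //; rewrite vx.
Qed.

Lemma symmetric_minimizer (R : realType) (n : nat) (p r theta q qs : R) :
  1 < p -> 1 < r -> 0 < theta -> theta <= 1 ->
  qs^-1 = theta * (p^-1 - n.+1%:R^-1) + (1 - theta) / r ->
  1 < qs -> qs < q ->
  exists u : lattice n.+1 -> R,
  [/\ forall x, 0 <= u x, symm u, mass q u = 1%E, gn_minimizer p q r theta u &
   exists2 A, 0 < A & energy p u = A%:E /\
   (theta < 1 -> exists2 B, 0 < B & mass r u = B%:E)].
Proof.
move=> p1 r1 t0 t1 hqs qs1 hq; have q0 : 0 < q by lra.
have [u [u0 su Mu Hu]] := exists_symmetric_limit p1 r1 t0 t1 hqs qs1 hq.
have nu : exists x, u x != 0.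
  by apply: (@mass_neq0 _ _ q); rewrite ?Mu gt_eqF// lte01.
have fu : levels_finite u by move=> t; apply: (mass_levels q0); rewrite Mu ltry.
have [A A0 [EA [HB HK]]] := functional_from_finite p1 r1 t0 t1 nu fu Hu.
have aD : gn_admissible p q u.
  split; last exact/lnorm_eq1.
  by apply: D0_of_levels => //; [exact: ltW|rewrite EA ltry].
exists u; split => //; last by exists A.
split => //; apply/eqP; rewrite eq_le; apply/andP; split; last first.
  by apply: ereal_inf_lbound; exists u.
apply: (le_trans HK); rewrite fineK//.
by apply: gn_inf_fin => //; lra.
Qed.

Theorem corollary1p8 (R : realType) (N : nat) (p r theta q qstar : R)
  (hN : (1 <= N)%N) (hp : 1 < p) (hr : 1 < r)
  (htheta0 : 0 <= theta) (htheta1 : theta <= 1)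
  (hqstar : qstar^-1 = theta * (p^-1 - N%:R^-1) + (1 - theta) / r)
  (hqstar1 : 1 < qstar) (hq : qstar < q) :
  exists u : 'rV[int]_N -> R,
    [/\
        [/\ forall x, 0 <= u x,
            exists x, 0 < u x
          & 0 < theta -> forall x, 0 < u x],
        schwarz_symmetric u,
        gn_minimizer p q r theta u,
        D0 p u /\ (theta < 1 -> ell r u)
      & exists lambda1 lambda2 : R,
          [/\ 0 < lambda1, 0 < lambda2
            & forall x,
                (if theta == 0 then 0 else lambda1 * plaplacian p u x)
                - (if theta == 1 then 0 else lambda2 * u x `^ (r - 1))
                + u x `^ (q - 1) = 0]].
Proof.
have q0 : 0 < q by lra.
have q1 : 1 < q by lra.
have r0 : 0 < r by lra.
move: htheta0; rewrite le_eqVlt => /predU1P[t0|t0].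
  have rE : qstar = r.
    by apply: invr_inj; rewrite hqstar -t0 mul0r add0r subr0 mul1r.
  have min : gn_minimizer p q r theta (@delta0 R N).
    by rewrite -t0; apply: delta0_minimizer => //; rewrite -rE ltW.
  have d0 x : 0 <= @delta0 R N x by rewrite ler0n.
  exists (@delta0 R N); split => //.
  - split => //; last by rewrite -t0 ltxx.
    by exists 0; rewrite /delta0 eqxx.
  - apply: symm_schwarz => //; first exact: symm_delta0.
    apply: C0plus_levels => //.
    exact/finitely_supported_levels/delta0_finitely_supported.
  - split; first by have [[]] := min.
    by move=> _; rewrite /ell/= /lnorm -/(mass r _) mass_delta0 ?gt_eqF// poweR1r ltry.
  - exists 1, 1; split => // x.
    rewrite -t0 eqxx eq_sym oner_eq0 mul1r sub0r /delta0.
    case: (x == 0); first by rewrite !powR1 addNr.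
    by rewrite !powR0 ?oppr0 ?addr0//; apply/eqP; lra.
case: N hN hqstar => // n _ hqstar.
have t01 : 0 <= theta <= 1 by rewrite ltW.
have [u [u0 su Mu min [A A0 [EA HB]]]] :=
  symmetric_minimizer hp hr t0 htheta1 hqstar hqstar1 hq.
have [B B0 EB] : exists2 B, 0 < B & theta < 1 -> mass r u = B%:E.
  have [tl|_] := ltP theta 1; last by exists 1.
  by have [B B0 EB] := HB tl; exists B.
have nu : exists x, u x != 0.
  by apply: (@mass_neq0 _ _ q); rewrite ?Mu gt_eqF// lte01.
have EL := euler_lagrange hp hr q1 t01 u0 EA Mu A0 B0 EB (proj2 min).
have l10 : 0 < 2 * theta / A by rewrite divr_gt0// mulr_gt0.
have up := positive_of_equation hp hr q1 l10 u0 nu EL.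
exists u; split => //.
- by split => //; have [x _] := nu; exists x.
- apply: symm_schwarz => //; apply: C0plus_levels => // t.
  by apply: (mass_levels q0); rewrite Mu ltry.
- split; first by have [[]] := min.
  by move=> tl; rewrite /ell/= /lnorm -/(mass r _) (EB tl) poweR_lty// ltry.
(* For theta = 1 any positive lambda2 will do. *)
- exists (2 * theta / A), (if theta == 1 then 1 else (1 - theta) / B); split => //.
    case: eqP => // /eqP tn1; rewrite divr_gt0// subr_gt0 lt_neqAle tn1//.
  move=> x; rewrite gt_eqF// -[RHS](EL x).
  by case: eqP => [->|//]; rewrite subrr !mul0r.
Qed.
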